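(* Let $m \geq n$, $A \in \mathbb{C}^{m\times m}$ and $B \in \mathbb{C}^{n \times n}$ be normal matrices, and let $X \in \mathbb{C}^{m\times n}$ satisfy $AX - XB = F$. Let $a, b \in \mathbb{R}$ with $0 < a < b$, and suppose that every eigenvalue of $A$ lies in $[-b,-a]$ and every eigenvalue of $B$ lies in $[a,b]$. Set $\mu_2 = \exp\left(\pi^2/\log(4b/a)\right)$. Suppose that there is a constant $K \geq 1$ such that $\sigma_{j+1}(F) \leq K \mu_2^{-j}\|F\|_2$ for all $0 \leq j < n$. Then for every triangular number $t = k(k+1)/2$ (with $k$ a positive integer) satisfying $1 \leq t < n$, \[ \sigma_{t+1}(X) \leq \frac{K b}{a}\left(6\sqrt{t} + 1\right) \mu_2^{-(\sqrt{8t+1}-1)/2}\, \|X\|_2 . \]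
   Context: For a matrix $M$, $\sigma_j(M)$ denotes its $j$th largest singular value, with $\sigma_j(M) = 0$ if $j$ exceeds the smaller dimension of $M$, and $\|M\|_2 = \sigma_1(M)$ is the spectral norm. *)

(* Defs.v *)
From HB Require Import structures.
From mathcomp Require Import all_boot all_order all_algebra.
From mathcomp Require Import complex sesquilinear spectral.
From mathcomp Require Import reals.
From mathcomp Require Import sequences.
From mathcomp.analysis Require Import exp trigo.
Set Implicit Arguments. Unset Strict Implicit. Unset Printing Implicit Defensive.
Import Order.TTheory GRing.Theory Num.Theory.
Local Open Scope ring_scope.
Local Open Scope complex_scope.
Local Open Scope sesquilinear_scope.

Definition adjmx (R : rcfType) (m n : nat) (M : 'M[R[i]]_(m, n)) : 'M[R[i]]_(n, m) :=
  M ^t*.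

Lemma gram_eig_ex (R : rcfType) (m n : nat) (M : 'M[R[i]]_(m, n)) :
  exists s : seq R[i], char_poly (adjmx M *m M) == \prod_(x <- s) ('X - x%:P).
Proof.
have [s Hs] := closed_field_poly_normal (char_poly (adjmx M *m M)).
by exists s; apply/eqP; rewrite Hs (monicP (char_poly_monic _)) scale1r.
Qed.

Definition gram_eigs (R : rcfType) (m n : nat) (M : 'M[R[i]]_(m, n)) : seq R[i] :=
  xchoose (gram_eig_ex M).

(* singular values of M, sorted in nonincreasing order, with multiplicity:
   square roots of the eigenvalues of M^* M (which are real and >= 0). *)
Definition singvals (R : rcfType) (m n : nat) (M : 'M[R[i]]_(m, n)) : seq R :=
  sort (fun x y : R => y <= x) [seq Num.sqrt (complex.Re z) | z <- gram_eigs M].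

(* sigma_j(M), 1-indexed; 0 if j exceeds the number of singular values (or j = 0) *)
Definition sigma (R : rcfType) (m n : nat) (M : 'M[R[i]]_(m, n)) (j : nat) : R :=
  if j is j'.+1 then nth 0 (singvals M) j' else 0.

Definition norm2 (R : rcfType) (m n : nat) (M : 'M[R[i]]_(m, n)) : R := sigma M 1.

(* Main.v *)
(** The right-hand side [F] is split along its singular vectors. If the
    right-hand side of a Sylvester equation has rank one and a polynomial [p] of
    degree at most [k] satisfies [|p(x)| <= E p(-x)] on [[a, b]], then the
    ADI iteration with [p(x) / p(-x)] approximates the solution by a matrix of
    rank at most [k] with relative error [E^2]. Giving rank [k - i] to the [i]-th piece of [F]
    uses the triangular number [k (k + 1) / 2] in total.

    It remains to find [p] with [E^2 <= (21 / 5) mu2^-k], the sum of the [k]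
    errors leaving room for a constant slightly larger than [4]. No elliptic
    functions are used. Averaging a polynomial of degree [2 k] with its
    reciprocal polynomial gives a polynomial of degree [k] in [(x + 1 / x) / 2]
    and does not increase [E]; this (a descending Landen transformation) turns
    bounds for [2 k] on [[1, 4 r^2]] into bounds for [k] on [[1, r]] and keeps
    [log (4 r) / k] constant. After many such steps the zeros can be taken in
    geometric progression: the effect of the two ends of the interval becomes
    negligible, and [E] tends to
    [phi(q) = prod_j ((1 - q^(2j+1)) / (1 + q^(2j+1)))^2] with [q = e^(-h/2)]
    and [h = log (4 r) / k]. Finally [phi(q) <= 2 e^(-pi^2 / (2 h))] follows
    from [phi(q^2)^2 <= 2 phi(q)], which reduces it to the leading order of
    [log phi] as [q] tends to [1], that is to [sum_j 1 / (2j+1)^2 = pi^2 / 8]. *)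
Require Import Defs.
From HB Require Import structures.
From mathcomp Require Import all_boot all_order all_algebra.
From mathcomp Require Import complex sesquilinear spectral.
From mathcomp Require Import reals.
From mathcomp Require Import sequences.
From mathcomp.analysis Require Import exp trigo.
From mathcomp Require Import perm classical_sets functions topology normedtype.
From mathcomp.analysis Require Import derive realfun.
From mathcomp Require Import ring lra zify.
Set Implicit Arguments. Unset Strict Implicit. Unset Printing Implicit Defensive.
Import Order.TTheory GRing.Theory Num.Theory numFieldNormedType.Exports.
Local Open Scope ring_scope.
Local Open Scope complex_scope.
Local Open Scope sesquilinear_scope.

(** * Polynomials that are small on [[a, b]] relative to [[-b, -a]] *)

(** [E] bounds [|p(x) / p(-x)|] on [[a, b]]. Since this quotient is inverted by [x -> -x], [E^2]
    bounds its Zolotarev quotient for the intervals [[a, b]] and [[-b, -a]]. *)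
Definition zolotarev_bound (R : realFieldType) (k : nat) (a b E : R) : Prop :=
  exists2 p : {poly R}, (size p <= k.+1)%N &
    forall x, a <= x <= b -> 0 < p.[- x] /\ `|p.[x]| <= E * p.[- x].

Lemma zolotarev_bound_sub (R : realFieldType) (k : nat) (a b c d E : R) :
  a <= c -> d <= b -> zolotarev_bound k a b E -> zolotarev_bound k c d E.
Proof.
move=> ac db [p sp Hp]; exists p => // x /andP[cx xd]; apply: Hp.
by rewrite (le_trans ac cx) (le_trans xd db).
Qed.

Lemma zolotarev_bound_scale (R : realFieldType) (k : nat) (c a b E : R) : 0 < c ->
  zolotarev_bound k a b E -> zolotarev_bound k (c * a) (c * b) E.
Proof.
move=> c0 [p sp Hp]; exists (p \Po (c^-1 *: 'X)).
  rewrite (leq_trans (size_comp_poly_leq _ _)) // ltnS size_scale ?invr_eq0 ?gt_eqF//.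
  by rewrite size_polyX muln1; case: (size p) sp.
move=> x /andP[ax xb]; rewrite !horner_comp !hornerZ !hornerX mulrN; apply: Hp.
by rewrite ler_pdivlMl // ax ler_pdivrMl.
Qed.

(* The polynomial representing [x ^+ i + x ^- i] in the variable [(x + x^-1) / 2]. *)
Fixpoint cheb2 (R : realFieldType) (i : nat) : {poly R} :=
  match i with
  | 0 => 2%:P
  | 1 => 2 *: 'X
  | (i1.+1 as i2).+1 => 2 *: ('X * cheb2 R i2) - cheb2 R i1
  end.

Lemma size_cheb2 (R : realFieldType) (i : nat) : (size (cheb2 R i) <= i.+1)%N.
Proof.
suff H : forall j, (size (cheb2 R j) <= j.+1)%N /\ (size (cheb2 R j.+1) <= j.+2)%N by case: (H i).
elim=> [|j [IH1 IH2]]; first by rewrite /= size_polyC (leq_trans (size_scale_leq _ _)) ?size_polyX ?leq_b1.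
split=> //; rewrite [cheb2 R j.+2]/= (leq_trans (size_polyD _ _)) // size_polyN geq_max; apply/andP; split.
  rewrite (leq_trans (size_scale_leq _ _)) // (leq_trans (size_polyMleq _ _)) // size_polyX /=.
  exact: IH2.
by rewrite (leq_trans IH1) // ltnW.
Qed.

Lemma horner_cheb2 (R : realFieldType) (i : nat) (x : R) : x != 0 ->
  (cheb2 R i).[(x + x^-1) / 2] = x ^+ i + x ^- i.
Proof.
move=> x0; suff H : forall j, (cheb2 R j).[(x + x^-1) / 2] = x ^+ j + x ^- j /\
  (cheb2 R j.+1).[(x + x^-1) / 2] = x ^+ j.+1 + x ^- j.+1 by case: (H i).
elim=> [|j [IH1 IH2]].
  by rewrite /= hornerC hornerZ hornerX !expr0 invr1; split => //; field.
split=> //; rewrite [cheb2 R j.+2]/= hornerD hornerN hornerZ hornerM hornerX IH1 IH2.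
rewrite !exprS; have := expf_neq0 j x0; move: (x ^+ j) => y y0; field.
by rewrite y0 x0.
Qed.

(** The two outer terms combine to [c 0 * x^(k+1) * (x^(k+1) + x^-(k+1))], which [cheb2] represents;
    the inner terms are [x] times a palindromic sum of smaller degree. *)
Lemma self_reciprocal (R : realFieldType) (k : nat) (c : nat -> R) :
  (forall i, (i <= k.*2)%N -> c (k.*2 - i)%N = c i) ->
  exists2 p : {poly R}, (size p <= k.+1)%N & forall x : R, x != 0 ->
    p.[(x + x^-1) / 2] * x ^+ k = \sum_(i < k.*2.+1) c i * x ^+ i.
Proof.
elim: k c => [|k IH] c Hc.
  exists (c 0%N)%:P; first by rewrite (leq_trans (size_polyC_leq1 _)).
  by move=> x x0; rewrite hornerC big_ord1.
have [|p sp Hp] := IH (fun i => c i.+1).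
  by move=> i Hi; rewrite -(Hc i.+1) ?doubleS ?subSS //; [congr c; lia | lia].
exists (c 0%N *: cheb2 R k.+1 + p).
  rewrite (leq_trans (size_polyD _ _)) // geq_max (leq_trans sp) // andbT.
  by rewrite (leq_trans (size_scale_leq _ _)) // size_cheb2.
move=> x x0; rewrite hornerD hornerZ horner_cheb2 // mulrDl.
rewrite doubleS big_ord_recr big_ord_recl /= -(Hc 0%N) // subn0 doubleS.
rewrite (exprS x k) (mulrC x) (mulrA p.[_]) Hp // mulr_suml expr0.
under [in RHS]eq_bigr => i _ do rewrite /bump /= add1n.
rewrite addrAC; congr (_ + _); last first.
  by apply: eq_bigr => i _; rewrite exprSr; ring.
rewrite -!mulrA mulrDl -exprSr mulVf ?expf_neq0 // -exprD.
rewrite (_ : (k.+1 + k.+1 = k.*2.+2)%N); last lia.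
by ring.
Qed.

(* Adding to [q] its reciprocal polynomial makes it a polynomial in
   [(x + x^-1) / 2]; the bound survives since a mediant of two fractions lies
   between them. *)
Lemma zolotarev_bound_fold (R : rcfType) (k : nat) (r E : R) : 1 <= r ->
  zolotarev_bound k.*2 (2 * r)^-1 (2 * r) E -> zolotarev_bound k 1 r E.
Proof.
move=> r1 [q sq Hq].
pose c i := q`_i + q`_(k.*2 - i).
have [|p sp Hp] := @self_reciprocal R k c.
  by move=> i Hi; rewrite /c subKn // addrC.
have qE x : x != 0 -> \sum_(i < k.*2.+1) c i * x ^+ i = q.[x] + x ^+ k.*2 * q.[x^-1].
  move=> x0; rewrite !(horner_coef_wide _ sq) mulr_sumr.
  rewrite [X in _ = _ + X](reindex_inj rev_ord_inj) -big_split /=.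
  apply: eq_bigr => i _; rewrite /c mulrDl; congr (_ + _).
  rewrite subSS mulrCA; congr (_ * _); rewrite exprVn.
  have ik : (i <= k.*2)%N by rewrite -ltnS.
  by rewrite -{2}(subnKC ik) exprD mulfK // expf_neq0.
have sgn y : (- y) ^+ k.*2 = y ^+ k.*2 :> R by rewrite -mul2n !exprM sqrrN.
(* Replacing [x] by [- x] multiplies [x ^+ k] by [(-1) ^+ k]; this sign makes the value at [- y]
   positive. *)
exists ((-1) ^+ k *: p); first by rewrite (leq_trans (size_scale_leq _ _)).
move=> y /andP[y1 yr].
(* This [x] solves [y = (x + x^-1) / 2]; both [x] and [x^-1] stay in the interval on which [q] is
   controlled. *)
pose s := Num.sqrt (y ^+ 2 - 1); pose x := y + s.
have s0 : 0 <= s := sqrtr_ge0 _.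
have s2 : s ^+ 2 = y ^+ 2 - 1 by rewrite sqr_sqrtr // subr_ge0 -[X in X <= _](expr1n _ 2) ler_sqr ?nnegrE; lra.
have sy : s <= y by rewrite -ler_sqr ?nnegrE //; lra.
have x1 : 1 <= x by rewrite /x; lra.
have x0 : 0 < x by lra.
have xN0 : x != 0 by rewrite gt_eqF.
have xV : x^-1 = y - s.
  by apply: (mulfI xN0); rewrite divff // /x mulrC -subr_sqr s2; ring.
have Ey : y = (x + x^-1) / 2 by rewrite xV /x; field.
have xr : x <= 2 * r by rewrite /x; lra.
have Hr0 : (0 : R) < 2 * r by lra.
have xb : (2 * r)^-1 <= x <= 2 * r.
  by rewrite xr andbT (le_trans _ x1) // invf_le1 //; lra.
have xVb : (2 * r)^-1 <= x^-1 <= 2 * r.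
  rewrite lef_pV2 ?posrE // xr /= (@le_trans _ _ 1) //; last lra.
  by rewrite invf_le1.
have [q1 q2] := Hq _ xb; have [q3 q4] := Hq _ xVb.
have xk0 : 0 < x ^+ k by rewrite exprn_gt0.
have xkk0 : 0 < x ^+ k.*2 by rewrite exprn_gt0.
have P1 : p.[y] * x ^+ k = q.[x] + x ^+ k.*2 * q.[x^-1] by rewrite Ey Hp // qE.
have P2 : ((-1) ^+ k *: p).[- y] * x ^+ k = q.[- x] + x ^+ k.*2 * q.[- x^-1].
  have := Hp (- x); rewrite oppr_eq0 => /(_ xN0); rewrite qE ?oppr_eq0 // sgn invrN.
  rewrite (_ : (- x - x^-1) / 2 = - y); last by rewrite Ey; field.
  by move=> <-; rewrite hornerZ (exprNn x) [RHS]mulrCA mulrA.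
have Y0 : 0 < ((-1) ^+ k *: p).[- y].
  by rewrite -(pmulr_lgt0 _ xk0) P2 addr_gt0 // mulr_gt0.
split=> //; rewrite -(ler_pM2r xk0) -mulrA P2 hornerZ normrM normrX normrN1 expr1n mul1r.
rewrite -{1}(gtr0_norm xk0) -normrM P1 (le_trans (ler_normD _ _)) // mulrDr lerD //.
by rewrite normrM (gtr0_norm xkk0) mulrCA ler_pM2l.
Qed.

(** A fold preceded by a rescaling leads from degree [2 k] on [[1, 4 r^2]] to degree [k] on
    [[1, r]]. As [4 * (4 r^2) = (4 r)^2], doubling the degree squares [4 r]. *)
Lemma zolotarev_bound_foldn (R : rcfType) (m k : nat) (r E : R) : 1 <= r ->
  zolotarev_bound (2 ^ m * k) 1 ((4 * r) ^+ (2 ^ m) / 4) E -> zolotarev_bound k 1 r E.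
Proof.
elim: m k r => [|m IH] k r r1.
  by rewrite expn0 mul1n expr1 [4 * r]mulrC mulfK ?pnatr_eq0.
have -> : (4 * r) ^+ (2 ^ m.+1) = (4 * (4 * r ^+ 2)) ^+ (2 ^ m).
  by rewrite expnS exprM; congr (_ ^+ _); ring.
have -> : (2 ^ m.+1 * k = 2 ^ m * k.*2)%N by rewrite expnS; lia.
have rr : 1 <= r ^+ 2 by rewrite -[X in X <= _](expr1n _ 2) ler_sqr ?nnegrE; lra.
move=> /IH H; apply: zolotarev_bound_fold => //.
have r0 : 0 < r by lra.
have c0 : 0 < (2 * r)^-1 by rewrite invr_gt0; lra.
have := zolotarev_bound_scale c0 (H _); rewrite mulr1.
have -> : (2 * r)^-1 * (4 * r ^+ 2) = 2 * r by field; rewrite gt_eqF.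
by apply; lra.
Qed.

(** * Zeros in geometric progression *)

(** As [M] grows, the square of this product tends to Jacobi's quotient
    [theta_4(q) / theta_3(q)]. *)
Definition theta_ratio (R : realFieldType) (q : R) (M : nat) : R :=
  \prod_(j < M) ((1 - q ^+ j.*2.+1) / (1 + q ^+ j.*2.+1)).

(** The windows [[w^(2i-1), w^(2i+1)]] are adjacent, so some even power of [w] is within a factor
    [w] of [x]; it serves as the centre around which zeros are paired. *)
Lemma geometric_cover (R : realFieldType) (w : R) (n : nat) (x : R) : 1 < w ->
  1 <= x <= w ^+ n.*2 -> exists2 i, (i <= n)%N & w ^+ i.*2 <= w * x /\ x <= w ^+ i.*2 * w.
Proof.
move=> w1; have w0 : 0 < w by lra.
elim: n => [|n IH] /andP[x1 xw].
  exists 0%N => //; rewrite expr0 in xw *; split; last by lra.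
  by rewrite (le_trans (ltW w1)) // ler_peMr // ltW.
have [xn|xn] := lerP x (w ^+ n.*2).
  by have [|i Hi H] := IH; rewrite ?x1 ?xn //; exists i => //; exact: leqW.
have [xn1|xn1] := lerP x (w ^+ n.*2 * w).
  exists n => //; split=> //.
  by rewrite (le_trans (ltW xn)) // ler_peMl // ?ltW //; lra.
exists n.+1 => //; split; last first.
  by rewrite (le_trans xw) // ler_peMr ?exprn_ge0 // ltW.
by rewrite doubleS !exprS ler_pM2l // mulrC ltW.
Qed.

(** Around the even power [w^(2i)] closest to [x] there are [M] zeros on either side. Those at
    [w^(2i) * c] and [w^(2i) / c] together contribute at most [((c - 1) / (c + 1))^2], and the
    product over [c = w^(2j+1)] is the square of [theta_ratio]. *)
Lemma zolotarev_bound_grid (R : realFieldType) (w : R) (n M : nat) : 1 < w ->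
  zolotarev_bound (n + M.*2) 1 (w ^+ n.*2) (theta_ratio w^-1 M ^+ 2).
Proof.
move=> w1; have w0 : 0 < w by lra.
have wn0 : w != 0 by rewrite gt_eqF.
(* The zeros are the odd powers from [w^(1-2M)] to [w^(2n+2M-1)]: [M] of them lie beyond each end of
   [[1, w^(2n)]], so that no [x] is too close to an end of the grid. *)
pose g j := w ^+ j.*2.+1 / w ^+ M.*2.
have g0 j : 0 < g j by rewrite divr_gt0 ?exprn_gt0.
exists (\prod_(j < n + M.*2) ((g j)%:P - 'X)).
  rewrite (leq_trans (size_poly_prod_leq _ _)) // -sum1_card.
  have : (\sum_(i < n + M.*2) size ((g i)%:P - 'X)%R <= (n + M.*2).*2)%N.
    apply: (@leq_trans (\sum_(i < n + M.*2) 2)); last by rewrite sum_nat_const card_ord muln2.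
    by apply: leq_sum => i _; rewrite -opprB size_polyN size_XsubC.
  rewrite sum1_card card_ord; set S := (\sum_(i < _) _)%N => HS; rewrite leq_subLR; move: HS.
  by rewrite -[X in (X.+1 <= _)%N]/S -addnn; lia.
move=> x Hx; have /andP[x1 xw] := Hx.
have x0 : 0 < x by lra.
rewrite !horner_prod; under eq_bigr => i _ do rewrite hornerD hornerN hornerC hornerX opprK.
under [in X in _ /\ X <= _]eq_bigr => i _ do rewrite hornerD hornerN hornerC hornerX.
have gx j : 0 < g j + x by rewrite addr_gt0.
split; first by apply: prodr_gt0.
rewrite normr_prod -ler_pdivrMr ?prodr_gt0 // -prodf_div.
have [i Hi [xi1 xi2]] := geometric_cover w1 Hx.
pose f j := `|g j - x| / (g j + x).
have f0 j : 0 <= f j by rewrite divr_ge0 // ltW.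
have f1 j : f j <= 1.
  rewrite ler_pdivrMr // mul1r; apply: (le_trans (ler_normB _ _)).
  by rewrite !gtr0_norm.
rewrite (_ : \prod_(i0 < _) _ = \prod_(0 <= j < n + M.*2) f j); last by rewrite big_mkord.
rewrite (@big_cat_nat _ _ _ i) //=; last lia.
rewrite (@big_cat_nat _ _ _ (i + M.*2)%N i) //=; try lia.
have P01 s : 0 <= \prod_(j <- s) f j <= 1 by rewrite prodr_ge0 //=; apply: prodr_ile1 => j _; rewrite f0 f1.
(* Every factor is at most 1, so only the [2 M] zeros next to [w^(2i)] are kept. *)
apply: (@le_trans _ _ (\prod_(i <= j < i + M.*2) f j)).
  set P1 := \prod_(_ <= _ < i) _; set P2 := \prod_(_ <= _ < i + _) _; set P3 := \prod_(_ <= _ < _) _.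
  have /andP[? ?] : 0 <= P1 <= 1 := P01 _; have /andP[? ?] : 0 <= P2 <= 1 := P01 _.
  have /andP[? ?] : 0 <= P3 <= 1 := P01 _.
  rewrite (@le_trans _ _ (P2 * P3)) //; last by rewrite ler_piMr.
  by rewrite ler_piMl // mulr_ge0.
rewrite -{1}[ i ]add0n big_addn addKn.
(* The block is folded at its centre, which pairs each zero with its mirror image. *)
rewrite (@big_cat_nat _ _ _ M) //=; last by lia.
rewrite [X in X * _]big_nat_rev /= add0n -{3}[M]add0n big_addn -addnn addnK -big_split /=.
rewrite /theta_ratio -prodrXl big_mkord; apply: ler_prod => j _.
rewrite mulr_ge0 //=.
have jM : (j < M)%N by [].
pose c := w ^+ j.*2.+1; pose d := x / w ^+ i.*2.
have wi : 0 < w ^+ i.*2 by rewrite exprn_gt0.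
have c0 : 0 < c by rewrite exprn_gt0.
have d0 : 0 < d by rewrite divr_gt0.
have wM : w ^+ M.*2 != 0 by rewrite expf_neq0.
have G1 : g (j + M + i)%N = w ^+ i.*2 * c.
  rewrite /g /c -exprD; apply: (mulIf wM); rewrite mulfVK // -exprD; congr (_ ^+ _); clear; lia.
have G2 : g (M - j.+1 + i)%N = w ^+ i.*2 / c.
  rewrite /g /c; apply: (mulIf wM); rewrite mulfVK //.
  apply: (mulIf (expf_neq0 j.*2.+1 wn0)); rewrite mulrAC mulfVK ?expf_neq0 // -!exprD; congr (_ ^+ _); clear -jM; lia.
have Ex : x = w ^+ i.*2 * d by rewrite /d mulrC divfK // gt_eqF.
rewrite /f G1 G2 Ex -!mulrBr -!mulrDr !normrM (gtr0_norm wi) !mulf_div.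
rewrite [w ^+ i.*2 * _ * _]mulrACA [w ^+ i.*2 * _ * (_ * (c + d))]mulrACA -mulf_div divff ?mul1r; last by rewrite mulf_neq0 ?gt_eqF.
have d1 : d <= w by rewrite /d ler_pdivrMr // mulrC.
have d2 : w^-1 <= d by rewrite /d ler_pdivlMr // ler_pdivrMl.
have cw : w <= c by rewrite /c exprS ler_peMr ?(ltW w0) // exprn_ege1 // ltW.
have c1 : 1 < c by lra.
have cd : 0 <= c - d by lra.
have cd' : 0 <= d - c^-1.
  by rewrite subr_ge0 (le_trans _ d2) // lef_pV2 // posrE.
rewrite (ger0_norm cd) distrC (ger0_norm cd').
rewrite exprVn -/c.
have cV : 0 < c^-1 by rewrite invr_gt0.
rewrite ler_pdivrMr ?mulr_gt0 ?addr_gt0 //.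
have cn0 : c != 0 by rewrite gt_eqF.
have -> : (1 - c^-1) / (1 + c^-1) = (c - 1) / (c + 1) by field; rewrite cn0 gt_eqF; lra.
(* A pair contributes most at [d = 1]: the difference is a nonnegative multiple of [(d - 1)^2]. *)
rewrite -subr_ge0.
have -> : ((c - 1) / (c + 1)) ^+ 2 * ((c^-1 + d) * (c + d)) - (d - c^-1) * (c - d) =
    2 * (c ^+ 2 + 1) * ((d - 1) / (c + 1)) ^+ 2.
  by field; rewrite cn0 gt_eqF; lra.
by rewrite mulr_ge0 ?sqr_ge0 // mulr_ge0 // addr_ge0 ?sqr_ge0.
Qed.

(** * The theta quotient *)

(** The [q]-Pochhammer symbol [(p; p)_n]; the quotient [qbin] built from it is the Gaussian binomial
    coefficient. *)
Definition qfact (R : realFieldType) (p : R) (n : nat) : R :=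
  \prod_(i < n) (1 - p ^+ i.+1).

Definition qbin (R : realFieldType) (p : R) (n m : nat) : R :=
  qfact p n / (qfact p m * qfact p (n - m)).

(** Truncated subtraction makes one summand vanish, so this is [|m - n|]. *)
Definition dist (m n : nat) : nat := (m - n + (n - m))%N.

(** The part [|m| <= N] of [theta_3(q)], the sum of [q^(m^2)] over all integers, with the index
    shifted by [N] to be a natural number. *)
Definition theta_sum (R : realFieldType) (q : R) (N : nat) : R :=
  \sum_(m < N.*2.+1) q ^+ (dist m N ^ 2).

(** By Jacobi's triple product, its limit times the infinite product of the [1 - q^(2j)], [j >= 1],
    is [theta_3(q)]. *)
Definition theta_prod (R : realFieldType) (q : R) (N : nat) : R :=
  \prod_(i < N) (1 + q ^+ i.*2.+1) ^+ 2.

Lemma qfact_gt0 (R : realFieldType) (p : R) (n : nat) : 0 <= p < 1 -> 0 < qfact p n.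
Proof.
move=> /andP[p0 p1]; apply: prodr_gt0 => i _.
by rewrite subr_gt0 exprn_ilt1.
Qed.

Lemma qfactS (R : realFieldType) (p : R) (n : nat) : qfact p n.+1 = qfact p n * (1 - p ^+ n.+1).
Proof. by rewrite /qfact big_ord_recr. Qed.

Lemma qfact_le (R : realFieldType) (p : R) (m n : nat) : 0 <= p < 1 -> (m <= n)%N ->
  qfact p n <= qfact p m.
Proof.
move=> p01; elim: n => [|n IH]; first by rewrite leqn0 => /eqP ->.
rewrite leq_eqVlt => /orP[/eqP -> //|]; rewrite ltnS => /IH; apply: le_trans.
rewrite qfactS ler_piMr ?(ltW (qfact_gt0 _ _)) // lerBlDr lerDl exprn_ge0 //.
by case/andP: p01.
Qed.

(** The [q]-Pascal rule. It fails at [m = n], where truncated subtraction gives [qbin p n n.+1] a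
    nonzero value. *)
Lemma qbinS (R : realFieldType) (p : R) (n m : nat) : 0 <= p < 1 -> (m < n)%N ->
  qbin p n.+1 m.+1 = qbin p n m.+1 + p ^+ (n - m) * qbin p n m.
Proof.
move=> p01 mn; rewrite /qbin subSS.
have -> : (n - m = (n - m.+1).+1)%N by lia.
rewrite !qfactS.
have -> : p ^+ n.+1 = p ^+ (n - m.+1).+1 * p ^+ m.+1 by rewrite -exprD; congr (_ ^+ _); lia.
have N0 j : 1 - p ^+ j.+1 != 0 by rewrite gt_eqF // subr_gt0 exprn_ilt1 //; case/andP: p01.
have F0 j : qfact p j != 0 by rewrite gt_eqF // qfact_gt0.
have := N0 (n - m.+1)%N; have := N0 m; move: (p ^+ (n - m.+1).+1) (p ^+ m.+1) => x y y1 x1.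
by field; rewrite ?F0 ?x1 ?y1.
Qed.

(** Induction with the [q]-Pascal rule; the two extreme terms, outside the range of that rule, are
    split off first. *)
Lemma q_binomial (R : realFieldType) (p z : R) (n : nat) : 0 <= p < 1 ->
  \prod_(i < n) (1 + z * p ^+ i) = \sum_(m < n.+1) qbin p n m * (p ^+ 'C(m, 2) * z ^+ m).
Proof.
move=> p01; have F0 j : qfact p j != 0 by rewrite gt_eqF // qfact_gt0.
have b0 k : qbin p k 0 = 1.
  by rewrite /qbin subn0 /qfact big_ord0 mul1r divff // -/(qfact p k).
have bn k : qbin p k k = 1.
  by rewrite /qbin subnn {3}/qfact big_ord0 mulr1 divff.
elim: n => [|n IH].
  by rewrite big_ord0 big_ord1 b0 /= !expr0 !mul1r.
rewrite big_ord_recr IH /= mulrDr mulr1.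
rewrite {1}big_ord_recl [X in _ + X * _]big_ord_recr [RHS]big_ord_recl [X in _ = _ + X]big_ord_recr /=.
rewrite !b0 !bn -!addrA; congr (_ + _); rewrite mulrDl !addrA; congr (_ + _).
  rewrite mulr_suml -big_split; apply: eq_bigr => i _ /=.
  rewrite /bump /= !add1n qbinS // binS bin1 !exprD mulrDl; congr (_ + _).
  have -> : p ^+ n = p ^+ (n - i) * p ^+ i by rewrite -exprD subnK // ltnW.
  by rewrite exprS; ring.
by rewrite /bump /= !add1n binS bin1 exprD exprS; ring.
Qed.

Lemma dist_sqr (m n : nat) : (dist m n ^ 2 + 2 * (m * n) = m ^ 2 + n ^ 2)%N.
Proof.
rewrite /dist; case: (leqP m n) => [mn|/ltnW nm].
  by rewrite -(subnKC mn) addKn; move: (n - m)%N => d; nia.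
by rewrite -(subnKC nm) addKn; move: (m - n)%N => d; nia.
Qed.

(** A finite triple product: the [q]-binomial theorem with base [q^2] and [z = q^(1-2N)]. Its
    factors pair up as [(1 + u) (1 + 1/u) = (1 + u)^2 / u] with [u = q^(2i+1)], and the exponents
    [2i+1] add up to [N^2]. *)
Lemma theta_prodE (R : realFieldType) (q : R) (N : nat) : 0 < q < 1 ->
  theta_prod q N = \sum_(m < N.*2.+1) qbin (q ^+ 2) N.*2 m * q ^+ (dist m N ^ 2).
Proof.
move=> /andP[q0 q1]; have qn0 k : q ^+ k != 0 by rewrite expf_neq0 // gt_eqF.
have p01 : 0 <= q ^+ 2 < 1 by rewrite sqr_ge0 exprn_ilt1 // ltW.
have := q_binomial (q / q ^+ N.*2) N.*2 p01.
set L := \prod_(_ < _) _ => HL.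
have EL : L = theta_prod q N / q ^+ (N ^ 2).
  rewrite /L -(big_mkord xpredT (fun i => 1 + q / q ^+ N.*2 * q ^+ 2 ^+ i)).
  rewrite (@big_cat_nat _ _ _ N) //=; last lia.
  rewrite big_nat_rev /= add0n [X in _ * X](_ : _ =
    \prod_(0 <= i < N) (1 + q / q ^+ N.*2 * q ^+ 2 ^+ (i + N))); last first.
    by rewrite -{1}[N]add0n big_addn -addnn addnK.
  rewrite !big_mkord -addnn.
  rewrite -big_split /=.
  have -> : q ^+ (N ^ 2) = \prod_(i < N) q ^+ i.*2.+1.
    rewrite -expr_sum; congr (_ ^+ _); elim: N {HL L} => [|N IH]; first by rewrite big_ord0.
    by rewrite big_ord_recr /= -IH; lia.
  rewrite /theta_prod -prodf_div; apply: eq_bigr => i _.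
  have E1 : q / q ^+ (N + N) * q ^+ 2 ^+ (N - i.+1) = (q ^+ i.*2.+1)^-1.
    apply: (mulIf (qn0 (N + N)%N)); rewrite mulrAC divfK ?qn0 //.
    apply: (mulIf (qn0 i.*2.+1)); rewrite [RHS]mulrAC mulVf ?qn0 // mul1r -exprM -exprS -exprD.
    by congr (_ ^+ _); have := ltn_ord i; clear; lia.
  have E2 : q / q ^+ (N + N) * q ^+ 2 ^+ (i + N) = q ^+ i.*2.+1.
    apply: (mulIf (qn0 (N + N)%N)); rewrite mulrAC divfK ?qn0 // -exprM -exprS -exprD.
    by congr (_ ^+ _); clear; lia.
  by rewrite E1 E2; have := qn0 i.*2.+1; move: (q ^+ _) => x x0; field.
move: HL; rewrite EL => /(canRL (mulfK (invr_neq0 (qn0 _)))); rewrite invrK mulr_suml => ->.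
apply: eq_bigr => m _; rewrite -mulrA; congr (_ * _).
rewrite expr_div_n -!exprM; apply: (mulIf (qn0 (N.*2 * m)%N)).
rewrite mulrAC -(mulrA _ (_ / _)) divfK ?qn0 // -!exprD; congr (_ ^+ _).
have := dist_sqr m N; rewrite -!mulnn; have := bin2_sum m.
have := mul_bin_diag m 1; rewrite bin1; case: (nat_of_ord m) => [|k] /=; lia.
Qed.

Lemma theta_sum_ge1 (R : realFieldType) (q : R) (N : nat) : 0 < q -> 1 <= theta_sum q N.
Proof.
move=> q0; have NN : (N < N.*2.+1)%N by rewrite ltnS -addnn leq_addr.
rewrite /theta_sum (bigD1 (Ordinal NN)) //= /dist subnn expr0 lerDl sumr_ge0 // => i _.
by rewrite exprn_ge0 // ltW.
Qed.

(** In the finite triple product each coefficient [qbin] times [qfact] of [2 N] is at most 1,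
    because [qfact] decreases. *)
Lemma theta_prod_le (R : realFieldType) (q : R) (N : nat) : 0 < q < 1 ->
  theta_prod q N * qfact (q ^+ 2) N.*2 <= theta_sum q N.
Proof.
move=> Hq; have /andP[q0 q1] := Hq.
have p01 : 0 <= q ^+ 2 < 1 by rewrite sqr_ge0 exprn_ilt1 // ltW.
rewrite theta_prodE // mulr_suml; apply: ler_sum => m _.
rewrite mulrAC ler_piMl ?exprn_ge0 ?(ltW q0) // /qbin mulrAC ler_pdivrMr ?mulr_gt0 ?qfact_gt0 // mul1r.
have mN : (m <= N.*2)%N by rewrite -ltnS.
by rewrite ler_pM ?(ltW (qfact_gt0 _ _)) ?qfact_le // leq_subr.
Qed.

(** Only the terms with [|m - N| <= J] are kept; for these both [m] and [2 N - m] are at least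
    [N - J], which bounds [qbin] from below. *)
Lemma theta_prod_ge (R : realFieldType) (q : R) (J N : nat) : 0 < q < 1 -> (J <= N)%N ->
  theta_sum q J * qfact (q ^+ 2) N.*2 <= theta_prod q N * qfact (q ^+ 2) (N - J) ^+ 2.
Proof.
move=> Hq JN; have /andP[q0 q1] := Hq.
have p01 : 0 <= q ^+ 2 < 1 by rewrite sqr_ge0 exprn_ilt1 // ltW.
have F0 n : 0 < qfact (q ^+ 2) n by exact: qfact_gt0.
have T0 m : 0 <= qbin (q ^+ 2) N.*2 m * q ^+ (dist m N ^ 2).
  by rewrite mulr_ge0 ?exprn_ge0 ?(ltW q0) // divr_ge0 ?mulr_ge0 // ltW.
rewrite theta_prodE // -(big_mkord xpredT (fun m => qbin (q ^+ 2) N.*2 m * q ^+ (dist m N ^ 2))).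
rewrite (@big_cat_nat _ _ _ (N - J)) //=; last by lia.
rewrite (@big_cat_nat _ _ _ (N + J).+1 (N - J)) //=; try lia.
rewrite -ler_pdivrMr ?exprn_gt0 //.
rewrite -[X in X <= _]add0r lerD ?sumr_ge0 // -[X in X <= _]addr0 lerD ?sumr_ge0 //.
rewrite [X in _ <= X](_ : _ = \sum_(0 <= m < (N + J).+1 - (N - J))
  qbin (q ^+ 2) N.*2 (m + (N - J)) * q ^+ (dist (m + (N - J)) N ^ 2)); last first.
  by rewrite -{1}[(N - J)%N]add0n big_addn.
have -> : ((N + J).+1 - (N - J) = J.*2.+1)%N by lia.
rewrite big_mkord -mulrA mulr_suml; apply: ler_sum => m _.
have -> : dist (m + (N - J)) N = dist m J by rewrite /dist; lia.
rewrite mulrC ler_wpM2r ?exprn_ge0 ?(ltW q0) // /qbin ler_pM2l // lef_pV2 ?posrE ?mulr_gt0 ?exprn_gt0 //.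
by rewrite expr2 ler_pM ?(ltW (F0 _)) ?qfact_le //; have := ltn_ord m; lia.
Qed.

(* Pairs of integers of the same parity are the pairs [(i + j, i - j)]; the
   square of the alternating sum removes the other pairs. *)
Lemma dist_half (x y a b N : nat) : (a.*2 = x + y -> b.*2 + y = x + N.*2 ->
  dist x N ^ 2 + dist y N ^ 2 = (dist a N ^ 2 + dist b N ^ 2) * 2)%N.
Proof.
move=> H1 H2; have := dist_sqr x N; have := dist_sqr y N; have := dist_sqr a N; have := dist_sqr b N.
have Hx : (x + N = a + b)%N by lia.
have Hy : (y + b = a + N)%N by lia.
have : ((x + N) ^ 2 = (a + b) ^ 2)%N by rewrite Hx.
have : ((y + b) ^ 2 = (a + N) ^ 2)%N by rewrite Hy.
have : (b * (y + b) = b * (a + N))%N by rewrite Hy.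
have : (N * (y + b) = N * (a + N))%N by rewrite Hy.
have : (N * (x + N) = N * (a + b))%N by rewrite Hx.
rewrite -!mulnn; clear; nia.
Qed.

(** A truncated form of [theta_3(q)^2 + theta_4(q)^2 = 2 theta_3(q^2)^2], with the square of the
    alternating sum [c] dropped. Truncation costs nothing, as the change of variables maps the pairs
    injectively into the same square of indices. *)
Lemma theta_sum_sqr_le (R : realFieldType) (q : R) (N : nat) : 0 < q ->
  theta_sum q N ^+ 2 <= 2 * theta_sum (q ^+ 2) N ^+ 2.
Proof.
move=> q0.
pose c := \sum_(m < N.*2.+1) (-1) ^+ m * q ^+ (dist m N ^ 2).
pose I := 'I_(N.*2.+1).
pose f (x : I * I) := q ^+ (dist x.1 N ^ 2 + dist x.2 N ^ 2).
have f0 x : 0 <= f x by rewrite exprn_ge0 // ltW.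
have E1 : theta_sum q N ^+ 2 = \sum_(x : I * I) f x.
  rewrite expr2 /theta_sum big_distrlr /= pair_big /=.
  by apply: eq_bigr => x _; rewrite /f exprD.
have E2 : c ^+ 2 = \sum_(x : I * I) (-1) ^+ (x.1 + x.2) * f x.
  rewrite expr2 /c big_distrlr /= pair_big /=.
  by apply: eq_bigr => x _; rewrite /f !exprD mulrACA.
have E3 : theta_sum (q ^+ 2) N ^+ 2 = \sum_(x : I * I) f x ^+ 2.
  rewrite expr2 /theta_sum big_distrlr /= pair_big /=.
  by apply: eq_bigr => x _; rewrite /f -exprD -!exprM mulnC.
have E4 : theta_sum q N ^+ 2 + c ^+ 2 = 2 * \sum_(x : I * I | ~~ odd (x.1 + x.2)) f x.
  rewrite E1 E2 -big_split /= (bigID (fun x : I * I => odd (x.1 + x.2))) /=.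
  rewrite big1 ?add0r => [|x xo]; last by rewrite -signr_odd xo expr1; ring.
  by rewrite mulr_sumr; apply: eq_bigr => x /negPf xo; rewrite -signr_odd xo expr0; ring.
apply: (@le_trans _ _ (theta_sum q N ^+ 2 + c ^+ 2)); first by rewrite lerDl sqr_ge0.
rewrite E4 ler_pM2l // E3.
(* Half sum and half difference, relative to the centre [N]; adding [N.*2] keeps the difference
   nonnegative. *)
pose h (x : I * I) : I * I := (inord ((x.1 + x.2)./2), inord ((x.1 + N.*2 - x.2)./2)).
pose P := [set x : I * I | ~~ odd (x.1 + x.2)].
have hE x : x \in P -> ((h x).1.*2 = x.1 + x.2 /\ (h x).2.*2 + x.2 = x.1 + N.*2)%N.
  rewrite inE => xo; have := ltn_ord x.1; have := ltn_ord x.2.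
  rewrite /h /=; have : ~~ odd (x.1 + N.*2 - x.2).
    by rewrite oddB ?oddD ?odd_double ?addbF -?oddD //; have := ltn_ord x.2; clear; lia.
  move: xo; case: x => x y /=; move: (nat_of_ord x) (nat_of_ord y) => {x y} u v.
  move=> /even_halfK H1 /even_halfK H2 lv lu; rewrite !inordK; lia.
have fh x : x \in P -> f x = f (h x) ^+ 2.
  by move=> /hE[H1 H2]; rewrite /f -exprM; congr (_ ^+ _); exact: dist_half.
have hI : {in P &, injective h}.
  move=> x y /hE[H1 H2] /hE[H3 H4] hxy; rewrite hxy in H1 H2.
  by rewrite [x]surjective_pairing [y]surjective_pairing; congr (_, _);
    apply: ord_inj; move: H1 H2 H3 H4; clear; lia.
have -> : \sum_(x : I * I | ~~ odd (x.1 + x.2)) f x = \sum_(x in P) f x.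
  by apply: eq_bigl => x; rewrite inE.
rewrite (eq_bigr _ fh) -(big_imset (fun x => f x ^+ 2) hI) /=.
by rewrite [X in _ <= X](bigID (mem (h @: P))) /= lerDl sumr_ge0 // => x _; rewrite exprn_ge0.
Qed.

Lemma sum_pow_le (R : realFieldType) (q : R) (J n : nat) : 0 <= q < 1 ->
  \sum_(i < n) q ^+ (J + i) <= q ^+ J / (1 - q).
Proof.
move=> /andP[q0 q1]; rewrite ler_pdivlMr ?subr_gt0 //.
under eq_bigr => i _ do rewrite exprD.
rewrite -mulr_sumr -mulrA; apply: ler_piMr; first exact: exprn_ge0.
by rewrite mulrC -opprB mulNr -subrX1 opprB lerBlDr lerDl exprn_ge0.
Qed.

(** The two outer blocks are dominated by geometric series starting at [q^J], and the inner sum is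
    at least 1, so the error can be made relative. *)
Lemma theta_sum_tail (R : realFieldType) (q : R) (J : nat) : 0 < q < 1 ->
  theta_sum q J.*2 <= theta_sum q J * (1 + 2 * (q ^+ J / (1 - q))).
Proof.
move=> /andP[q0 q1]; have q01 : 0 <= q < 1 by rewrite ltW.
pose f N m := q ^+ (dist m N ^ 2).
have fE N : theta_sum q N = \sum_(0 <= m < N.*2.+1) f N m by rewrite big_mkord.
have qle m n : (n <= m)%N -> q ^+ m <= q ^+ n by move=> mn; rewrite ler_wiXn2l // ltW.
rewrite fE (@big_cat_nat _ _ _ J) //=; last lia.
rewrite (@big_cat_nat _ _ _ (J + J.*2.+1)%N J) //=; try lia.
have -> : \sum_(J <= m < J + J.*2.+1) f J.*2 m = theta_sum q J.
  rewrite fE -{1}[J]add0n big_addn addKn; apply: eq_bigr => m _.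
  by rewrite /f; congr (_ ^+ (_ ^ 2)); rewrite /dist; lia.
have T1 := theta_sum_ge1 J q0.
have H1 : \sum_(0 <= m < J) f J.*2 m <= q ^+ J / (1 - q).
  rewrite big_nat_rev /= add0n big_mkord; apply: le_trans (sum_pow_le J J q01).
  apply: ler_sum => m _; apply: qle; have := ltn_ord m; rewrite /dist; nia.
have H2 : \sum_(J + J.*2.+1 <= m < J.*2.*2.+1) f J.*2 m <= q ^+ J / (1 - q).
  rewrite -{1}[(J + J.*2.+1)%N]add0n big_addn big_mkord; apply: le_trans (sum_pow_le J _ q01).
  apply: ler_sum => m _; apply: qle; have := ltn_ord m; rewrite /dist; nia.
have e0 : 0 <= q ^+ J / (1 - q) by rewrite divr_ge0 ?exprn_ge0 ?subr_ge0 // ltW.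
by move: H1 H2 T1 e0; move: (q ^+ J / _) (theta_sum _ _) => e t; nra.
Qed.

(** Weierstrass's inequality: a product of terms [1 - x_i] with [0 <= x_i <= 1] is at least 1 minus
    the sum of the [x_i]. *)
Lemma qfact_tail (R : realFieldType) (p : R) (m n : nat) : 0 <= p < 1 ->
  qfact p m * (1 - p ^+ m / (1 - p)) <= qfact p (m + n).
Proof.
move=> p01; have /andP[p0 p1] := p01; have p1' : 0 < 1 - p by rewrite subr_gt0.
have -> : qfact p (m + n) = qfact p m * \prod_(i < n) (1 - p ^+ (m + i).+1).
  rewrite /qfact -!(big_mkord xpredT (fun i => 1 - p ^+ i.+1)) (@big_cat_nat _ _ _ m) ?leq_addr //=.
  congr (_ * _); rewrite -{1}[m]add0n big_addn addKn big_mkord.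
  by apply: eq_bigr => i _; rewrite addnC.
rewrite ler_pM2l ?qfact_gt0 //; apply: le_trans (_ : 1 - \sum_(i < n) p ^+ (m + i) <= _).
  by rewrite lerD2l lerN2 sum_pow_le.
elim: n => [|n IH]; first by rewrite !big_ord0 subr0.
rewrite !big_ord_recr /=.
have A0 : 0 <= \prod_(i < n) (1 - p ^+ (m + i).+1) <= 1.
  rewrite prodr_ge0 /= => [|i _]; last by rewrite subr_ge0 exprn_ile1 // ltW.
  apply: prodr_ile1 => i _; rewrite subr_ge0 exprn_ile1 ?(ltW p1) //=.
  by rewrite lerBlDr lerDl exprn_ge0.
have x0 : 0 <= p ^+ (m + n).+1 <= p ^+ (m + n).
  by rewrite exprn_ge0 // ler_wiXn2l // ltW.
move: IH A0 x0; move: (p ^+ (m + n).+1) (p ^+ (m + n)) (\prod_(_ < _) _) (\sum_(_ < _) _).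
by move=> x y P S IH /andP[P0 P1] /andP[x0 xy]; nra.
Qed.

Lemma qfact_double (R : realFieldType) (p : R) (n : nat) :
  qfact p n.*2 = qfact (p ^+ 2) n * \prod_(i < n) (1 - p ^+ i.*2.+1).
Proof.
rewrite /qfact -big_split /=; elim: n => [|n IH]; first by rewrite !big_ord0.
by rewrite doubleS !big_ord_recr /= IH -mulrA -exprM mul2n doubleS [X in _ = _ * X]mulrC.
Qed.

(** For large [J] the error [e] disappears and [phi(q^2)^2 <= 2 phi(q)] remains. The quotient [X]
    below is [theta_3(q) / theta_3(q^2)] up to truncation, and the square of the latter is at most
    2. *)
Lemma theta_ratio_double (R : realFieldType) (q : R) (J : nat) (e := q ^+ 2 ^+ J / (1 - q ^+ 2)) :
  0 < q < 1 -> e <= 1 ->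
  theta_ratio (q ^+ 2) J.*2 ^+ 4 * (1 - e) ^+ 4 <=
    2 * theta_ratio q J.*2 ^+ 2 * (1 + 2 * e) ^+ 2.
Proof.
move=> Hq e1; have /andP[q0 q1] := Hq.
set Q := q ^+ 2 in e e1 *; set N := J.*2.
have HQ : 0 < Q < 1 by rewrite exprn_gt0 // exprn_ilt1 // ltW.
have /andP[Q0 Q1] := HQ.
set P := Q ^+ 2.
have HP : 0 < P < 1 by rewrite exprn_gt0 // exprn_ilt1 // ltW.
have /andP[P0 P1] := HP.
have PQ : P <= Q by rewrite /P expr2 ler_piMl // ltW.
have Q01 : 0 <= Q < 1 by rewrite ltW.
have P01 : 0 <= P < 1 by rewrite ltW.
have e0 : 0 <= e by rewrite divr_ge0 ?exprn_ge0 ?subr_ge0 // ltW.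
pose S := \prod_(i < N) (1 - Q ^+ i.*2.+1).
have S0 : 0 < S by apply: prodr_gt0 => i _; rewrite subr_gt0 exprn_ilt1 // ltW.
have t0 : 0 < theta_ratio q N.
  apply: prodr_gt0 => i _; rewrite divr_gt0 // ?subr_gt0 ?exprn_ilt1 ?(ltW q0) //.
  by rewrite addr_gt0 // exprn_gt0.
have th0 x : 0 < x -> 0 < theta_prod x N.
  by move=> x0; apply: prodr_gt0 => i _; rewrite exprn_gt0 // addr_gt0 ?exprn_gt0.
have split1 : qfact Q N.*2 = qfact P N * S := qfact_double Q N.
(* Factor by factor with [x = q^(2i+1)], using [1 - x^2 = (1 - x) (1 + x)]. *)
have ratio : theta_ratio Q N ^+ 2 = theta_ratio q N * (S * theta_prod q N / theta_prod Q N).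
  rewrite /theta_ratio /S /theta_prod -!big_split /= -prodf_div -big_split /= -prodrXl.
  apply: eq_bigr => i _; rewrite /Q -!exprM mulnC exprM.
  have : 0 < q ^+ i.*2.+1 < 1 by rewrite exprn_gt0 // exprn_ilt1 // ltW.
  move: (q ^+ _) => x /andP[x0 x1]; field.
  by rewrite !gt_eqF //; nra.
have H1 := theta_prod_le N Hq.
have JN : (J <= N)%N by rewrite /N -addnn leq_addr.
have H2 := theta_prod_ge HQ JN.
have H3 := theta_sum_sqr_le N q0.
have H4 := theta_sum_tail J HQ; rewrite -/e in H4.
have e'e : P ^+ J / (1 - P) <= e.
  rewrite /e ler_pM ?exprn_ge0 ?invr_ge0 ?subr_ge0 ?(ltW P0) ?(ltW P1) ?(ltW q0) //.
    by rewrite lerXn2r ?nnegrE // ltW.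
  by rewrite lef_pV2 ?posrE ?subr_gt0 // lerD2l lerN2.
have T n : qfact P J * (1 - e) <= qfact P (J + n).
  apply: le_trans (qfact_tail J n P01).
  by rewrite ler_pM2l ?qfact_gt0 // lerD2l lerN2.
have H5 := T J; have H6 := T (J + J + J)%N.
have NJ : (N - J = J)%N by rewrite /N -addnn addnK.
rewrite NJ in H2; rewrite addnn -/N in H5.
rewrite (_ : J + (J + J + J) = N.*2)%N in H6; last by rewrite /N; clear; lia.
rewrite split1 in H1.
have F0 : 0 < qfact P N := qfact_gt0 N P01; have G0 : 0 < qfact P N.*2 := qfact_gt0 _ P01.
have K0 : 0 < qfact P J := qfact_gt0 J P01.
have A0 := th0 _ q q0; have B0 := th0 _ Q Q0.
have W1 := theta_sum_ge1 J Q0.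
have U1 := theta_sum_ge1 N q0; have V1 := theta_sum_ge1 N Q0.
move: (qfact P N) (qfact P N.*2) (qfact P J) (theta_prod q N) (theta_prod Q N)
  (theta_sum Q J) (theta_sum q N) (theta_sum Q N) (theta_ratio q N) (theta_ratio Q N)
  t0 ratio H1 H2 H3 H4 H5 H6 F0 G0 K0 A0 B0 W1 U1 V1.
move=> F G K A B W U V t t' t0 ratio H1 H2 H3 H4 H5 H6 F0 G0 K0 A0 B0 W1 U1 V1.
have W0 : 0 < W by lra.
pose X := S * A / B.
have X0 : 0 < X by rewrite divr_gt0 // mulr_gt0.
have XB : X * B = S * A by rewrite /X divfK // gt_eqF.
rewrite -/X in ratio; clearbody X.
have e1' : 0 <= 1 - e by rewrite subr_ge0.
(* The triple product is used as an upper bound at [q] and as a lower bound at [Q]; the two losses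
   [1 - e] come from the tails of [qfact P]. *)
have L1 : X * (1 - e) ^+ 2 * W <= U.
  apply: le_trans H1; rewrite -(ler_pM2r G0).
  have -> : A * (F * S) * G = X * B * (F * G) by rewrite XB; ring.
  apply: (@le_trans _ _ (X * (1 - e) ^+ 2 * (B * K ^+ 2))).
    by rewrite -[Z in Z <= _]mulrA ler_wpM2l // mulr_ge0 ?exprn_ge0 // ltW.
  have -> : X * (1 - e) ^+ 2 * (B * K ^+ 2) = X * B * ((K * (1 - e)) * (K * (1 - e))) by ring.
  apply: ler_wpM2l; first by rewrite mulr_ge0 // ltW.
  by apply: ler_pM => //; rewrite mulr_ge0 // ltW.
have L2 : (X * (1 - e) ^+ 2) ^+ 2 <= 2 * (1 + 2 * e) ^+ 2.
  rewrite -(@ler_pM2r _ (W ^+ 2)) ?exprn_gt0 // -exprMn.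
  apply: (@le_trans _ _ (U ^+ 2)).
    have XW : 0 <= X * (1 - e) ^+ 2 * W by rewrite !mulr_ge0 ?exprn_ge0 // ltW.
    by rewrite ler_sqr ?nnegrE // (le_trans XW).
  apply: (le_trans H3); rewrite -mulrA ler_pM2l // -exprMn mulrC.
  have V0 : 0 <= V by lra.
  by rewrite ler_sqr ?nnegrE ?(le_trans V0) // mulrC.
have -> : t' ^+ 4 * (1 - e) ^+ 4 = t ^+ 2 * (X * (1 - e) ^+ 2) ^+ 2.
  by rewrite (_ : 4%N = (2 * 2)%N) // exprM ratio; ring.
by rewrite [X in _ <= X](_ : _ = t ^+ 2 * (2 * (1 + 2 * e) ^+ 2)) ?ler_pM2l ?exprn_gt0 //; ring.
Qed.

(** * Its behaviour as [q] tends to 1 *)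

Lemma is_derive_ge0_le (R : realType) (f df : R -> R) (a b : R) : a <= b ->
  (forall x, a <= x <= b -> is_derive x 1 f (df x)) ->
  (forall x, a <= x <= b -> 0 <= df x) -> f a <= f b.
Proof.
move=> ab fd df0.
have [||c /[!in_itv] /= cab E] := @MVT_segment R f df a b ab.
- by move=> y /[!in_itv] /= /andP[ay yb]; apply: fd; rewrite !ltW.
- apply: derivable_within_continuous => y /[!in_itv] /= yab.
  by have [] := fd y yab.
- by rewrite -subr_ge0 E mulr_ge0 ?df0 // subr_ge0.
Qed.

Lemma mulr_cos_le_sin (R : realType) (x : R) : 0 <= x <= pi / 2 -> x * cos x <= sin x.
Proof.
move=> /andP[x0 xpi].
have := @is_derive_ge0_le R (@sin R - (@id R * @cos R) : R -> R) (fun y => y * sin y) 0 x x0.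
rewrite /= !fctE /= sin0 mul0r subr0 subr_ge0; apply => y /andP[y0 yx].
  apply: is_derive_eq; rewrite /GRing.scale /=; ring.
by rewrite mulr_ge0 // sin_ge0_pi // y0 (le_trans yx) // (le_trans xpi) // ler_pdivrMr // ler_peMr ?pi_ge0 //; lra.
Qed.

(** The inverse of [sin^2] is [1 + cot^2], and [x cos x <= sin x] says that [cot x <= 1 / x]. *)
Lemma invr_sin2_le (R : realType) (x : R) : 0 < x < pi / 2 -> (sin x ^+ 2)^-1 <= 1 + (x ^+ 2)^-1.
Proof.
move=> /andP[x0 xpi]; have s0 : 0 < sin x by apply: sin_gt0_pihalf; rewrite x0.
have c0 : 0 <= cos x by apply: cos_ge0_pihalf; rewrite !ltW //; have := @pihalf_ge1 R; lra.
have xc : x * cos x <= sin x by apply: mulr_cos_le_sin; rewrite !ltW.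
rewrite -(ler_pM2r (exprn_gt0 2 s0)) mulVf ?gt_eqF ?exprn_gt0 // mulrDl mul1r.
rewrite -{1}(cos2Dsin2 x) addrC lerD2l ler_pdivlMl ?exprn_gt0 //.
by rewrite -exprMn ler_sqr ?nnegrE // ?mulr_ge0 // ltW.
Qed.

(** Since [sin x = 2 sin (x/2) cos (x/2)], the term at [x] is a quarter of the sum of the terms at
    [x/2] and [pi/2 - x/2]; this splitting turns the angles for [m] into those for [m + 1]. *)
Lemma sum_invr_sin2 (R : realType) (m : nat) :
  \sum_(j < 2 ^ m) (sin (j.*2.+1%:R * pi / 2 ^+ m.+2 : R) ^+ 2)^-1 = 2 * 4 ^+ m.
Proof.
elim: m => [|m IH].
  rewrite big_ord1 expr0 mulr1 mul1r.
  have := sin_mulr2n (pi / 2 ^+ 2 : R); have := cos_mulr2n (pi / 2 ^+ 2 : R).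
  have -> : (pi / 2 ^+ 2) *+ 2 = pi / 2 :> R by field.
  rewrite cos_pihalf; have := cos2Dsin2 (pi / 2 ^+ 2 : R).
  move: (cos _) (sin _) => c s E1 E2 _.
  have -> : s ^+ 2 = 2^-1 by lra.
  by rewrite invrK.
have half (x : R) : 0 < x < pi -> (sin x ^+ 2)^-1 =
    ((sin (x / 2) ^+ 2)^-1 + (sin (pi / 2 - x / 2) ^+ 2)^-1) / 4.
  move=> /andP[x0 xpi].
  have -> : sin (pi / 2 - x / 2) = cos (x / 2) by rewrite -(opprB (x / 2)) sinN sinBpihalf opprK.
  have {1}-> : x = x / 2 *+ 2 by field.
  have s0 : 0 < sin (x / 2) by apply: sin_gt0_pi; lra.
  have c0 : 0 < cos (x / 2) by apply: cos_gt0_pihalf; lra.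
  rewrite sin_mulr2n; have := cos2Dsin2 (x / 2); move: s0 c0; move: (sin _) (cos _) => s c s0 c0 E.
  have -> : (s ^+ 2)^-1 + (c ^+ 2)^-1 = (c ^+ 2 + s ^+ 2) / (s ^+ 2 * c ^+ 2).
    by field; rewrite !gt_eqF.
  by rewrite E; field; rewrite !gt_eqF.
have -> : 2 * 4 ^+ m.+1 = 4 * (2 * 4 ^+ m) :> R by rewrite exprS; ring.
have IH' : \sum_(j < 2 ^ m) (sin (j.*2.+1%:R * pi / 2 ^+ m.+2 : R) ^+ 2)^-1 =
  \sum_(j < 2 ^ m) ((sin (j.*2.+1%:R * pi / 2 ^+ m.+2 / 2) ^+ 2)^-1 +
    (sin (pi / 2 - j.*2.+1%:R * pi / 2 ^+ m.+2 / 2) ^+ 2)^-1) / 4.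
  apply: eq_bigr => j _; rewrite half //.
    apply/andP; split; first by apply: divr_gt0; [apply: mulr_gt0; [exact: ltr0Sn|exact: pi_gt0]|exact: exprn_gt0].
    rewrite ltr_pdivrMr ?exprn_gt0 // mulrC ltr_pM2l ?pi_gt0 // -natrX ltr_nat.
    by have := ltn_ord j; rewrite !expnS; clear; lia.
rewrite -IH IH' -mulr_suml mulrC divfK ?pnatr_eq0 // big_split /=.
rewrite -(big_mkord xpredT (fun j => (sin (j.*2.+1%:R * pi / 2 ^+ m.+3 : R) ^+ 2)^-1)).
rewrite (@big_cat_nat _ _ _ (2 ^ m)) //=; last by rewrite leq_pexp2l.
congr (_ + _).
  rewrite big_mkord; apply: eq_bigr => j _; rewrite (exprS _ m.+2).
  by congr (((sin _) ^+ 2)^-1); rewrite invfM mulrA mulrAC.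
(* The second half of the angles, in reverse order, consists of the complements [pi/2 - x/2]. *)
rewrite expnS mul2n -addnn -{1}[(2 ^ m)%N]add0n big_addn addnK big_nat_rev /= add0n big_mkord.
apply: eq_bigr => j _; congr (((sin _) ^+ 2)^-1).
rewrite (_ : ((2 ^ m - j.+1 + 2 ^ m).*2.+1 = 2 ^ m.+2 - j.*2.+1)%N); last first.
  by have := ltn_ord j; rewrite !expnS; clear; lia.
rewrite natrB; last by have := ltn_ord j; rewrite !expnS; clear; lia.
rewrite natrX (exprS _ m.+2); have : 2 ^+ m.+2 != 0 :> R by rewrite expf_neq0 ?pnatr_eq0.
by move: (2 ^+ m.+2) => A A0; field.
Qed.

(** Bounding each term of the exact trigonometric sum by [1 + 1/x^2] gives [pi^2 / 8] with an
    explicit error. *)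
Lemma sum_odd_invr_sqr_ge (R : realType) (m : nat) :
  pi ^+ 2 / 8 * (1 - (2 ^+ m)^-1) <= \sum_(j < 2 ^ m) (j.*2.+1%:R ^+ 2)^-1 :> R.
Proof.
have pi0 := @pi_gt0 R.
have H : 2 * 4 ^+ m <= 2 ^+ m + 16 * 4 ^+ m / pi ^+ 2 * \sum_(j < 2 ^ m) (j.*2.+1%:R ^+ 2)^-1 :> R.
  rewrite -sum_invr_sin2 mulr_sumr.
  have -> : 2 ^+ m = \sum_(j < 2 ^ m) (1 : R) by rewrite sumr_const card_ord -natrX.
  rewrite -big_split /=; apply: ler_sum => j _.
  apply: (le_trans (invr_sin2_le _)).
    apply/andP; split; first by apply: divr_gt0; [apply: mulr_gt0; [exact: ltr0Sn|exact: pi_gt0]|exact: exprn_gt0].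
    rewrite ltr_pdivrMr ?exprn_gt0 // exprS mulrA divfK ?pnatr_eq0 // mulrC ltr_pM2l // -natrX ltr_nat.
    by have := ltn_ord j; rewrite !expnS; clear; lia.
  rewrite lerD2l expr_div_n exprMn invf_div -exprM mulnC exprM.
  have -> : (2 ^+ 2 : R) ^+ m.+2 = 16 * 4 ^+ m.
    by rewrite [2 ^+ 2](_ : _ = 4) ?expr2 -?natrM // !exprS; ring.
  by rewrite invfM -!mulrA ler_pM2l // ler_pM2l ?exprn_gt0 // mulrC.
have q0 : 0 < 4 ^+ m :> R by rewrite exprn_gt0.
have E4 : 4 ^+ m = 2 ^+ m * 2 ^+ m :> R by rewrite -exprMn; congr (_ ^+ _); lra.
have t0 : 0 < 2 ^+ m :> R by rewrite exprn_gt0.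
move: H; move: (\sum_(j < _) _) => S; rewrite E4; move: t0; move: (2 ^+ m) => t t0.
move: pi0; move: (@pi R) => p pi0 H.
rewrite -(@ler_pM2l _ (16 * (t * t) / p ^+ 2)); last by rewrite divr_gt0 ?exprn_gt0 // !mulr_gt0.
rewrite (_ : _ * (_ * (1 - t^-1)) = 2 * (t * t) - 2 * t); last by field; rewrite !gt_eqF.
by lra.
Qed.

(** The exponent is a truncation of the series of [ln ((1 + z) / (1 - z))]. The derivative
    [2 / (1 - y^2)] dominates the corresponding finite geometric sum. *)
Lemma ln_ratio_le (R : realType) (J : nat) (z : R) : 0 <= z < 1 ->
  (1 - z) / (1 + z) <= expR (- (2 * \sum_(j < J) z ^+ j.*2.+1 / j.*2.+1%:R)).
Proof.
move=> /andP[z0 z1].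
pose p : {poly R} := 2 *: \sum_(j < J) j.*2.+1%:R^-1 *: 'X^(j.*2.+1).
have pE y : p.[y] = 2 * \sum_(j < J) y ^+ j.*2.+1 / j.*2.+1%:R.
  rewrite hornerZ horner_sum; congr (_ * _); apply: eq_bigr => j _.
  by rewrite hornerZ hornerXn mulrC.
have p'E y : p^`().[y] = 2 * \sum_(j < J) (y ^+ 2) ^+ j.
  rewrite /p derivZ hornerZ; congr (_ * _); rewrite raddf_sum /= horner_sum; apply: eq_bigr => j _.
  by rewrite derivZ derivXn hornerZ hornerMn hornerXn -[X in _ * X]mulr_natl mulKf ?pnatr_eq0 // -exprM mul2n.
have H : p.[z] <= ln (1 + z) - ln (1 - z).
  pose f : R -> R := (@ln R \o (cst 1 + @id R)) - (@ln R \o (cst 1 - @id R)) - horner p.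
  have fD y : 0 <= y <= z -> is_derive y 1 f (2 / (1 - y ^+ 2) - p^`().[y]).
    move=> /andP[y0 yz]; rewrite /f.
    have y1 : 0 < 1 - y by lra.
    have y2 : 0 < 1 + y by lra.
    have D1 : is_derive ((cst 1 + @id R) y) 1 (@ln R) (1 + y)^-1 := is_derive1_ln y2.
    have D2 : is_derive ((cst 1 - @id R) y) 1 (@ln R) (1 - y)^-1 := is_derive1_ln y1.
    apply: is_derive_eq.
    by rewrite /GRing.scale /=; field; rewrite !gt_eqF //; nra.
  have := is_derive_ge0_le z0 fD.
  rewrite /f !fctE /= addr0 subr0 ln1 pE big1 ?mulr0 => [|j _]; last by rewrite expr0n mul0r.
  rewrite !subr0 subr_ge0; apply => y /andP[y0 yz].
  rewrite p'E subr_ge0 ler_pdivlMr; last by nra.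
  have := subrX1 (y ^+ 2) J; have : 0 <= (y ^+ 2) ^+ J by rewrite exprn_ge0 // sqr_ge0.
  by move: (\sum_(i < J) _) ((y ^+ 2) ^+ J) => S T T0 E; nra.
have z1' : 0 < 1 - z by rewrite subr_gt0.
have z2 : 0 < 1 + z by lra.
rewrite -pE -[X in X <= _]lnK ?posrE ?divr_gt0 // ler_expR ln_div ?posrE //; lra.
Qed.

(** * Infinite products and the bound on [phi] *)

Section ThetaLimit.
Local Open Scope classical_set_scope.

Lemma theta_ratio_ge0 (R : realFieldType) (q : R) (M : nat) : 0 < q < 1 -> 0 <= theta_ratio q M.
Proof.
move=> /andP[q0 q1]; apply: prodr_ge0 => i _.
have /andP[h0 h1] : 0 <= q ^+ i.*2.+1 <= 1 by rewrite exprn_ge0 ?exprn_ile1 // ltW.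
by rewrite divr_ge0 ?subr_ge0 // addr_ge0.
Qed.

Lemma theta_ratio_nonincreasing (R : realType) (q : R) : 0 < q < 1 ->
  nonincreasing_seq (theta_ratio q).
Proof.
move=> q01; apply/nonincreasing_seqP => n; have /andP[q0 q1] := q01.
rewrite /theta_ratio big_ord_recr /= -/(theta_ratio q n) ler_piMr ?theta_ratio_ge0 //.
have : 0 < q ^+ n.*2.+1 by rewrite exprn_gt0.
by move: (q ^+ _) => x x0; rewrite ler_pdivrMr; lra.
Qed.

Lemma theta_ratio_is_cvg (R : realType) (q : R) : 0 < q < 1 -> cvgn (theta_ratio q).
Proof.
move=> q01; apply: nonincreasing_is_cvgn; first exact: theta_ratio_nonincreasing.
by exists 0 => _ [n _ <-]; exact: theta_ratio_ge0.
Qed.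

(** With [phi] the square of the limit this is [phi(q^2)^2 <= 2 phi(q)], the limiting case of
    [theta_ratio_double]. *)
Lemma theta_ratio_lim_double (R : realType) (q : R) : 0 < q < 1 ->
  limn (theta_ratio (q ^+ 2)) ^+ 4 <= 2 * limn (theta_ratio q) ^+ 2.
Proof.
move=> q01; have /andP[q0 q1] := q01.
have Q01 : 0 < q ^+ 2 < 1 by rewrite exprn_gt0 // exprn_ilt1 // ltW.
have /andP[Q0 Q1] := Q01.
set A := limn _; set B := limn _.
pose e n := q ^+ 2 ^+ n / (1 - q ^+ 2).
have e0 : e @ \oo --> 0.
  rewrite -(mul0r (1 - q ^+ 2)^-1); apply: cvgMr_tmp; apply: cvg_expr.
  by rewrite ger0_norm // ltW.
have tB : theta_ratio q @ \oo --> B := theta_ratio_is_cvg q01.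
have A0 : 0 <= A.
  apply: limr_ge; first exact: theta_ratio_is_cvg.
  by apply: nearW => n; exact: theta_ratio_ge0.
have c1 : (fun n => A ^+ 4 * (1 - e n) ^+ 4) @ \oo --> A ^+ 4 * (1 - 0) ^+ 4.
  apply: cvgMl_tmp; apply: (continuous_cvg _ (@exprn_continuous _ 4 _)).
  by apply: cvgB => //; exact: cvg_cst.
have c2 : (fun n => 2 * theta_ratio q n ^+ 2 * (1 + 2 * e n) ^+ 2) @ \oo -->
    2 * B ^+ 2 * (1 + 2 * 0) ^+ 2.
  apply: cvgM.
    by apply: cvgMl_tmp; apply: (continuous_cvg _ (@exprn_continuous _ 2 _)).
  apply: (continuous_cvg _ (@exprn_continuous _ 2 _)).
  by apply: cvgD; [exact: cvg_cst|apply: cvgMl_tmp].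
rewrite subr0 expr1n mulr1 in c1; rewrite mulr0 addr0 expr1n mulr1 in c2.
apply: (ler_cvg_to c1 c2); near=> n.
have en : e n <= 1.
  near: n; move/cvgr_le : e0 => /(_ 1); apply; exact: ltr01.
have en0 : 0 <= e n by rewrite divr_ge0 ?exprn_ge0 ?subr_ge0 // ltW.
(* Monotonicity passes from the index [n.*2] to the limit on the left and to the index [n] on the
   right. *)
apply: (@le_trans _ _ (theta_ratio (q ^+ 2) n.*2 ^+ 4 * (1 - e n) ^+ 4)).
  rewrite ler_wpM2r ?exprn_ge0 ?subr_ge0 // lerXn2r ?nnegrE ?theta_ratio_ge0 //.
  exact: (nonincreasing_cvgn_ge (theta_ratio_nonincreasing Q01) (theta_ratio_is_cvg Q01)).
apply: (le_trans (theta_ratio_double q01 en)).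
rewrite -/(e n); apply: ler_wpM2r; first by rewrite exprn_ge0 // addr_ge0 // mulr_ge0.
rewrite ler_pM2l // lerXn2r ?nnegrE ?theta_ratio_ge0 //.
by apply: theta_ratio_nonincreasing => //; rewrite -addnn leq_addr.
Unshelve. all: by end_near.
Qed.

(** The logarithmic bound is applied to each factor; after exchanging the sums, the sum over the
    factors is a finite geometric one. *)
Lemma theta_ratio_le_expR (R : realType) (q : R) (N J : nat) : 0 < q < 1 ->
  theta_ratio q N <= expR (- (2 * \sum_(j < J)
    q ^+ j.*2.+1 * (1 - q ^+ (j.*2.+1.*2 * N)) / (1 - q ^+ j.*2.+1.*2) / j.*2.+1%:R)).
Proof.
move=> /andP[q0 q1].
have -> : - (2 * \sum_(j < J)
    q ^+ j.*2.+1 * (1 - q ^+ (j.*2.+1.*2 * N)) / (1 - q ^+ j.*2.+1.*2) / j.*2.+1%:R) =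
  \sum_(i < N) - (2 * \sum_(j < J) (q ^+ i.*2.+1) ^+ j.*2.+1 / j.*2.+1%:R).
  rewrite sumrN -mulr_sumr exchange_big /=; congr (- (_ * _)); apply: eq_bigr => j _.
  rewrite -mulr_suml; congr (_ / _).
  have Q1 : q ^+ j.*2.+1.*2 < 1 by rewrite exprn_ilt1 // ltW.
  rewrite (eq_bigr (fun i : 'I_N => q ^+ j.*2.+1 * (q ^+ j.*2.+1.*2) ^+ i)) => [|i _]; last first.
    by rewrite -!exprM -exprD; congr (_ ^+ _); clear; nia.
  rewrite -mulr_sumr exprM -mulrA; congr (_ * _).
  apply: (@mulIf _ (1 - q ^+ j.*2.+1.*2)); first by rewrite subr_eq0 gt_eqF.
  rewrite divfK; last by rewrite subr_eq0 gt_eqF.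
  by rewrite -opprB subrX1 mulrC -mulrN opprB.
rewrite expR_sum /theta_ratio; apply: ler_prod => i _; apply/andP; split.
  have /andP[h0 h1] : 0 <= q ^+ i.*2.+1 <= 1 by rewrite exprn_ge0 ?exprn_ile1 // ltW.
  by rewrite divr_ge0 ?subr_ge0 // addr_ge0.
by apply: ln_ratio_le; rewrite exprn_ge0 ?exprn_ilt1 // ltW.
Qed.

(** With [o = 2j+1] and [q = e^(-y)], [q^o / (1 - q^(2o)) >= (1 - o y) / (2 o y)], so the [j]-th
    term of the exponent is at least [1 / (o^2 y) - 1]. The losses of 1 add up to [J]. *)
Lemma theta_ratio_lim_le (R : realType) (y : R) (J : nat) : 0 < y ->
  limn (theta_ratio (expR (- y))) <=
    expR (J%:R - (\sum_(j < J) (j.*2.+1%:R ^+ 2)^-1) / y).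
Proof.
move=> y0; set q := expR (- y).
have q01 : 0 < q < 1 by rewrite expR_gt0 expR_lt1 oppr_lt0.
have /andP[q0 q1] := q01.
pose w j := q ^+ j.*2.+1 / (1 - q ^+ j.*2.+1.*2) / j.*2.+1%:R.
have w0 j : 0 <= w j.
  by rewrite !divr_ge0 ?subr_ge0 ?exprn_ge0 ?exprn_ile1 // ltW.
pose W := \sum_(j < J) w j.
have W0 : 0 <= W by apply: sumr_ge0.
have H1 : limn (theta_ratio q) <= expR (- (2 * W)).
  (* The geometric sums with [n] terms reach at least the fraction [1 - q^n] of their limits. *)
  pose f n := expR (- (2 * W) + 2 * W * q ^+ n).
  have cf : f @ \oo --> expR (- (2 * W) + 2 * W * 0).
    apply: (continuous_cvg _ (@continuous_expR R _)).
    apply: cvgD; [exact: cvg_cst|apply: cvgMl_tmp; apply: cvg_expr].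
    by rewrite ger0_norm // ltW.
  rewrite mulr0 addr0 in cf; apply: (cvgr_to_ge cf); apply: nearW => n.
  apply: le_trans (nonincreasing_cvgn_ge (theta_ratio_nonincreasing q01) (theta_ratio_is_cvg q01) n) _.
  apply: (le_trans (theta_ratio_le_expR n J q01)); rewrite ler_expR.
  rewrite lerNl opprD opprK -mulrA -mulrBr ler_pM2l //.
  rewrite -{1}[W]mulr1 -mulrBr mulr_suml; apply: ler_sum => j _.
  set b := 1 - q ^+ (_ * _).
  rewrite (mulrAC _ b) (mulrAC _ b) -/(w j) ler_wpM2l // lerD2l lerN2.
  by rewrite ler_wiXn2l ?(ltW q0) ?(ltW q1) //; clear; nia.
apply: (le_trans H1); rewrite ler_expR lerNl opprB /W mulr_sumr mulr_suml lerBlDr.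
have -> : J%:R = \sum_(j < J) 1 :> R by rewrite sumr_const card_ord.
rewrite -big_split /=; apply: ler_sum => j _.
have n0 : 0 < j.*2.+1%:R :> R by exact: ltr0Sn.
have n1 : 1 <= j.*2.+1%:R :> R by rewrite ler1n.
have Eq k : q ^+ k = expR (- (k%:R * y)) by rewrite -expRM_natl mulrN.
have d0 : 0 < 1 - q ^+ j.*2.+1.*2 by rewrite subr_gt0 exprn_ilt1 // ltW.
have d1 : 1 - q ^+ j.*2.+1.*2 <= 2 * (j.*2.+1%:R * y).
  have := expR_ge1Dx (- (j.*2.+1.*2%:R * y)); rewrite -Eq -muln2 natrM; lra.
have u1 : 1 - j.*2.+1%:R * y <= q ^+ j.*2.+1.
  by rewrite Eq; exact: expR_ge1Dx.
have u0 : 0 < q ^+ j.*2.+1 by rewrite exprn_gt0.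
rewrite /w; move: (1 - q ^+ j.*2.+1.*2) (q ^+ j.*2.+1) (j.*2.+1%:R : R) n0 n1 d0 d1 u1 u0.
move=> d u n n0 n1 d0 d1 u1 u0.
have ny : 0 < n * y by rewrite mulr_gt0.
apply: (@le_trans _ _ (2 * (u / (2 * (n * y)) / n) + 1)).
  rewrite -(@ler_pM2r _ (n ^+ 2 * y)) ?mulr_gt0 ?exprn_gt0 //.
  rewrite (_ : (n ^+ 2)^-1 / y * (n ^+ 2 * y) = 1); last by field; rewrite !gt_eqF.
  rewrite (_ : _ * (n ^+ 2 * y) = u + n * (n * y)); last by field; rewrite !gt_eqF.
  by nra.
rewrite lerD2r ler_pM2l // ler_pM2r ?invr_gt0 // ler_pM2l // lef_pV2 ?posrE //.
by rewrite mulr_gt0.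
Qed.

(** Normalised as [B = A^2 / 2], the duplication inequality becomes [B(x)^2 <= B(x/2)]. Iteration
    bounds [B(y)] by a high root of [B] near 0, where the crude estimate by finitely many terms is
    enough. *)
Lemma theta_ratio_small (R : realType) (y e : R) : 0 < y -> 0 < e ->
  exists M, theta_ratio (expR (- y)) M ^+ 2 <= 2 * expR (- (pi ^+ 2 / (4 * y)) + e).
Proof.
move=> y0 e0; pose A (x : R) := limn (theta_ratio (expR (- x))).
have q01 (x : R) : 0 < x -> 0 < expR (- x) < 1.
  by move=> x0; rewrite expR_gt0 expR_lt1 oppr_lt0.
have A0 x : 0 < x -> 0 <= A x.
  move=> x0; apply: limr_ge; first exact: theta_ratio_is_cvg (q01 _ x0).
  by apply: nearW => n; apply: theta_ratio_ge0; exact: q01.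
pose B x := A x ^+ 2 / 2.
have B0 x : 0 <= B x by rewrite divr_ge0 // sqr_ge0.
have BD x : 0 < x -> B x ^+ 2 <= B (x / 2).
  move=> x0; have := theta_ratio_lim_double (q01 _ (divr_gt0 x0 (ltr0Sn R 1))).
  rewrite -expRM_natl mulrN mulrCA mulfV ?pnatr_eq0 // mulr1 -/(A x) -/(A (x / 2)) /B.
  move: (A x) (A (x / 2)) => s t; rewrite (exprM s 2 2 : s ^+ 4 = _); move: (s ^+ 2) (t ^+ 2) => u v uv.
  have -> : (u / 2) ^+ 2 = u ^+ 2 / 4 by field.
  by rewrite ler_pdivrMr //; have -> : v / 2 * 4 = 2 * v by field.
have BDn m x : 0 < x -> B x ^+ (2 ^ m) <= B (x / 2 ^+ m).
  elim: m x => [|m IH] x x0; first by rewrite expr1 expr0 divr1.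
  rewrite expnS exprM.
  apply: (@le_trans _ _ (B (x / 2) ^+ (2 ^ m))); first by rewrite lerXn2r ?nnegrE ?exprn_ge0 ?BD.
  by apply: (le_trans (IH _ (divr_gt0 x0 (ltr0Sn R 1)))); rewrite exprS invfM mulrA.
have BE m : B y <= expR (- (pi ^+ 2 / (4 * y)) + (2 ^+ m)^-1 * (pi ^+ 2 / (4 * y) + 2)).
  pose S := \sum_(j < 2 ^ m) (j.*2.+1%:R ^+ 2)^-1 : R.
  (* With [2 m] halvings but only [2^m] terms of the series, the loss [2 * 2^m] becomes [2 / 2^m]
     after taking the [T]-th root. *)
  pose T : R := 2 ^+ (m + m).
  have T0 : 0 < T by rewrite exprn_gt0.
  have N0 : (0 < 2 ^ (m + m))%N by rewrite expn_gt0.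
  rewrite -(@ler_pXn2r _ _ N0) ?nnegrE ?expR_ge0 //.
  apply: (le_trans (BDn _ _ y0)); rewrite -/T.
  have yT : 0 < y / T by rewrite divr_gt0.
  have H := theta_ratio_lim_le (2 ^ m) yT; rewrite -/(A _) -/S in H.
  apply: (@le_trans _ _ (A (y / T) ^+ 2)).
    by rewrite /B ler_pdivrMr // ler_peMr ?sqr_ge0 // ler1n.
  apply: (@le_trans _ _ (expR ((2 ^ m)%:R - S / (y / T)) ^+ 2)).
    by rewrite lerXn2r ?nnegrE ?expR_ge0 ?A0.
  rewrite -!expRM_natl ler_expR !natrX -/T.
  have HS := sum_odd_invr_sqr_ge R m; rewrite -/S in HS.
  have t0 : 0 < 2 ^+ m :> R by rewrite exprn_gt0.
  have TE : T = 2 ^+ m * 2 ^+ m by rewrite /T exprD.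
  rewrite TE; clear -HS t0 y0; move: HS t0; move: (2 ^+ m) (@pi R) S => t p S HS t0.
  have -> : 2%:R * (t - S / (y / (t * t))) = 2 * t - S * (2 * (t * t) / y).
    by field; rewrite !gt_eqF.
  have -> : t * t * (- (p ^+ 2 / (4 * y)) + t^-1 * (p ^+ 2 / (4 * y) + 2)) =
      2 * t - (p ^+ 2 / 8 * (1 - t^-1)) * (2 * (t * t) / y).
    by field; rewrite !gt_eqF.
  by rewrite lerD2l lerN2 ler_wpM2r // divr_ge0 ?mulr_ge0 // ltW.
have BL : B y <= expR (- (pi ^+ 2 / (4 * y)) + e / 2).
  pose c : R := pi ^+ 2 / (4 * y) + 2.
  have c0 : 0 < c by rewrite addr_gt0 // divr_gt0 ?mulr_gt0 ?exprn_gt0 ?pi_gt0.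
  have : (fun m => 2^-1 ^+ m : R) @ \oo --> 0 by apply: cvg_expr; rewrite ger0_norm; lra.
  move/cvgr_le => /(_ (e / 2 / c)); case; first by rewrite !divr_gt0.
  move=> m _ /(_ m (leqnn m)) /= Hm; apply: (le_trans (BE m)).
  by rewrite ler_expR lerD2l -/c -ler_pdivlMr // -exprVn.
have cA : (fun n => theta_ratio (expR (- y)) n ^+ 2) @ \oo --> A y ^+ 2.
  apply: (continuous_cvg _ (@exprn_continuous _ 2 _)).
  exact: theta_ratio_is_cvg (q01 _ y0).
move/cvgr_lt: cA => /(_ (2 * expR (- (pi ^+ 2 / (4 * y)) + e))); case.
  apply: (@le_lt_trans _ _ (2 * expR (- (pi ^+ 2 / (4 * y)) + e / 2))).
    by rewrite mulrC -ler_pdivrMr.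
  by rewrite ltr_pM2l // ltr_expR ltrD2l; lra.
by move=> M _ /(_ M (leqnn M)) /= HM; exists M; exact: ltW.
Qed.

End ThetaLimit.

(** * The polynomials of degree [k] *)

(** A geometric grid with [2^m k] zeros is folded [m] times. The number [2 M] of zeros spent at the
    ends does not depend on [m], so a slight excess in the spacing pays for them once [m] is
    large. *)
Lemma zolotarev_upper_bound (R : realType) (k : nat) (a b : R) : (0 < k)%N -> 0 < a -> a < b ->
  exists2 E : R, zolotarev_bound k a b E &
    0 <= E /\ E ^+ 2 <= 21 / 5 * expR (- (k%:R * (pi ^+ 2 / ln (4 * b / a)))).
Proof.
move=> k0 a0 ab; pose r := b / a.
have r1 : 1 < r by rewrite ltr_pdivlMr // mul1r.
have -> : 4 * b / a = 4 * r by rewrite mulrA.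
have r41 : 1 < 4 * r by lra.
have r40 : 0 < 4 * r by lra.
pose L := ln (4 * r); have L0 : 0 < L by apply: ln_gt0.
have K0 : 0 < k%:R :> R by rewrite ltr0n.
have pi0 := @pi_gt0 R.
pose x := k%:R / L; have x0 : 0 < x by rewrite divr_gt0.
pose s := pi ^+ 2 * x; have s0 : 0 < s by rewrite mulr_gt0 // exprn_gt0.
have s500 : 0 < 50 * s by rewrite mulr_gt0.
(* The logarithmic spacing [2 * y] of the grid is slightly larger than [L / k],
   which leaves room for a bounded number of additional grid points. *)
pose y := (1 + (50 * s)^-1) / (2 * x).
have y0 : 0 < y by rewrite divr_gt0 ?addr_gt0 ?mulr_gt0 ?invr_gt0.
(* Squaring turns the tolerance [1/100] into [1/50], and the widened spacing costs another [1/50];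
   finally [4 e^(1/25) <= 25/6 <= 21/5]. *)
have [M HM] := theta_ratio_small y0 (divr_gt0 (ltr01 : 0 < 1 :> R) (ltr0Sn R 99)).
exists (theta_ratio (expR (- y)) M ^+ 2); last first.
  split; first by rewrite sqr_ge0.
  have -> : k%:R * (pi ^+ 2 / L) = s by rewrite /s /x mulrCA.
  have H2 : theta_ratio (expR (- y)) M ^+ 2 ^+ 2 <= (2 * expR (- (pi ^+ 2 / (4 * y)) + 1 / 100)) ^+ 2.
    by rewrite lerXn2r ?nnegrE ?sqr_ge0 ?mulr_ge0 ?expR_ge0.
  apply: (le_trans H2); rewrite exprMn -expRM_natl.
  apply: (@le_trans _ _ (2 ^+ 2 * expR (1 / 25 - s))).
    rewrite ler_pM2l ?exprn_gt0 // ler_expR.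
    have -> : pi ^+ 2 / (4 * y) = 25 * s ^+ 2 / (1 + 50 * s).
      rewrite /y /s; have xn : x != 0 by rewrite gt_eqF.
      have : pi ^+ 2 != 0 :> R by rewrite gt_eqF // exprn_gt0.
      have : 1 + 50 * (pi ^+ 2 * x) != 0 by rewrite gt_eqF // addr_gt0.
      by move: (pi ^+ 2) => p p1 p0; field; rewrite p1 p0 xn.
    have s50 : 0 < 1 + 50 * s by rewrite addr_gt0.
    have : s - 1 / 50 <= 2 * (25 * s ^+ 2 / (1 + 50 * s)) by rewrite mulrA ler_pdivlMr //; lra.
    by move: (25 * s ^+ 2 / (1 + 50 * s)) => u Hu; lra.
  rewrite expRD mulrA ler_pM2r ?expR_gt0 //.
  have Hc : 24 / 25 <= (expR (1 / 25))^-1 :> R.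
    by rewrite -expRN; have := expR_ge1Dx (- (1 / 25) : R); lra.
  have c0 : 0 < expR (1 / 25) :> R := expR_gt0 _.
  have := ler_wpM2r (ltW c0) Hc; rewrite mulVf ?gt_eqF //.
  by move: (expR (1 / 25)) => c H; lra.
(* The excess logarithmic length per [k] grid steps; [2^m] times this must cover the length [4 y M]
   of the [2 M] steps lost at the ends. *)
pose g := 2 * y * k%:R - L.
have gE : g = L / (50 * s).
  rewrite /g /y /x; have Kn : k%:R != 0 :> R by rewrite gt_eqF.
  have Ln : L != 0 by rewrite gt_eqF.
  have sn : s != 0 by rewrite gt_eqF.
  by field; rewrite sn Kn Ln.
have g0 : 0 < g by rewrite gE divr_gt0.
have X0 : 0 <= 4 * y * M%:R / g by rewrite divr_ge0 ?(ltW g0) // (mulr_ge0 (mulr_ge0 _ (ltW y0))).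
have [m mM mX] : exists2 m, (M.*2 <= 2 ^ m)%N & 4 * y * M%:R / g <= 2 ^+ m.
  have [N HN] : exists N, 4 * y * M%:R / g <= N%:R by exists (Num.bound (4 * y * M%:R / g)); exact: ltW (archi_boundP X0).
  have H : (maxn M.*2 N < 2 ^ maxn M.*2 N)%N by rewrite ltn_expl.
  exists (maxn M.*2 N); first by rewrite (leq_trans (leq_maxl M.*2 N)) // ltnW.
  by rewrite (le_trans HN) // -natrX ler_nat (leq_trans (leq_maxr M.*2 N)) // ltnW.
pose n := (2 ^ m * k - M.*2)%N.
have nE : (n + M.*2 = 2 ^ m * k)%N.
  by rewrite subnK // (leq_trans mM) // leq_pmulr.
have w1 : 1 < expR y by rewrite expR_gt1.
have := zolotarev_bound_grid n M w1; rewrite nE -expRN => Hgrid.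
have Hr : zolotarev_bound k 1 r (theta_ratio (expR (- y)) M ^+ 2).
  apply: (@zolotarev_bound_foldn _ m); first exact: ltW.
  apply: zolotarev_bound_sub Hgrid => //.
  have t0 : 0 < (4 * r) ^+ (2 ^ m) by rewrite exprn_gt0.
  apply: (@le_trans _ _ ((4 * r) ^+ (2 ^ m))).
    by rewrite ler_pdivrMr // ler_peMr ?(ltW t0) //; lra.
  rewrite -[X in X <= _]lnK ?posrE // -expRM_natl ler_expR lnXn // -/L -[L *+ _]mulr_natl.
  have : (n + M.*2)%:R = (2 ^ m * k)%:R :> R by rewrite nE.
  rewrite natrD natrM -!muln2 !natrM natrX => E.
  have : 4 * y * M%:R <= 2 ^+ m * g by rewrite -ler_pdivrMr.
  have -> : n%:R = 2 ^+ m * k%:R - M%:R * 2 :> R by rewrite -E addrK.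
  by rewrite /g; move: (2 ^+ m) (M%:R : R) (k%:R : R) => t u v; lra.
have := zolotarev_bound_scale a0 Hr.
by rewrite mulr1 /r mulrC divfK // gt_eqF.
Qed.

(** * Singular values *)

Definition sqnormc (R : rcfType) (z : R[i]) : R := complex.Re z ^+ 2 + complex.Im z ^+ 2.

Definition sqnorm (R : rcfType) (n : nat) (v : 'cV[R[i]]_n) : R := \sum_i sqnormc (v i 0).

(** Operator norm at most [c], squared to avoid roots. Only [c ^+ 2] enters, whence the separate
    conditions [0 <= c] below. *)
Definition opbound (R : rcfType) (m n : nat) (M : 'M[R[i]]_(m, n)) (c : R) : Prop :=
  forall v : 'cV_n, sqnorm (M *m v) <= c ^+ 2 * sqnorm v.

Lemma sqnormc_ge0 (R : rcfType) (z : R[i]) : 0 <= sqnormc z.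
Proof. by rewrite addr_ge0 ?sqr_ge0. Qed.

Lemma sqnormcE (R : rcfType) (z : R[i]) : (sqnormc z)%:C = z^* * z.
Proof. by rewrite /sqnormc add_Re2_Im2 sqr_normc mulrC. Qed.

Lemma sqnormcM (R : rcfType) (z w : R[i]) : sqnormc (z * w) = sqnormc z * sqnormc w.
Proof. by case: z => a b; case: w => c d; rewrite /sqnormc /=; ring. Qed.

Lemma sqnormc_real (R : rcfType) (x : R) : sqnormc x%:C = x ^+ 2.
Proof. by rewrite /sqnormc /= expr0n addr0. Qed.

Lemma sqnormc_eq0 (R : rcfType) (z : R[i]) : sqnormc z = 0 -> z = 0.
Proof.
move=> /(congr1 (fun x => x%:C)); rewrite sqnormcE => /eqP; rewrite mulf_eq0 conjc_eq0 orbb.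
by move/eqP.
Qed.

Lemma sqnorm_ge0 (R : rcfType) (n : nat) (v : 'cV[R[i]]_n) : 0 <= sqnorm v.
Proof. by apply: sumr_ge0 => i _; exact: sqnormc_ge0. Qed.

Lemma sqnormE (R : rcfType) (n : nat) (v : 'cV[R[i]]_n) : (v^t* *m v) 0 0 = (sqnorm v)%:C.
Proof.
rewrite mxE rmorph_sum; apply: eq_bigr => i _.
by apply: etrans (esym (sqnormcE _)); rewrite !mxE.
Qed.

Lemma adjmxM (C : numClosedFieldType) (m n p : nat) (A : 'M[C]_(m, n)) (B : 'M[C]_(n, p)) :
  (A *m B)^t* = B^t* *m A^t*.
Proof. by rewrite trmx_mul map_mxM. Qed.

Lemma sqnorm_unitary (R : rcfType) (n : nat) (V : 'M[R[i]]_n) (v : 'cV[R[i]]_n) :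
  V \is unitarymx -> sqnorm (V *m v) = sqnorm v.
Proof.
move=> /unitarymxP VV; apply: (@complexI R); rewrite -!sqnormE.
by rewrite adjmxM -mulmxA (mulmxA _ V) (mulmx1C VV) mul1mx.
Qed.

(** A weighted Cauchy-Schwarz inequality; with the two norm bounds as weights it yields the triangle
    inequality for [opbound] without square roots. *)
Lemma sqnormc_addle (R : rcfType) (c d : R) (z w : R[i]) : 0 < c -> 0 < d ->
  sqnormc (z + w) <= (c + d) * (sqnormc z / c + sqnormc w / d).
Proof.
move=> c0 d0; case: z => a b; case: w => a' b'; rewrite /sqnormc /=.
have H (x y : R) : (x + y) ^+ 2 <= (c + d) * (x ^+ 2 / c + y ^+ 2 / d).
  rewrite -subr_ge0.
  have -> : (c + d) * (x ^+ 2 / c + y ^+ 2 / d) - (x + y) ^+ 2 = (d * x - c * y) ^+ 2 / (c * d).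
    by field; rewrite !gt_eqF.
  by rewrite divr_ge0 ?sqr_ge0 // mulr_ge0 // ltW.
have := H a a'; have := H b b'; rewrite !mulrDl !mulrDr; lra.
Qed.

Lemma opboundD (R : rcfType) (m n : nat) (M N : 'M[R[i]]_(m, n)) (c d : R) :
  0 <= c -> 0 <= d -> opbound M c -> opbound N d -> opbound (M + N) (c + d).
Proof.
move=> c0 d0 HM HN v; rewrite mulmxDl.
have Z w : sqnorm w <= 0 -> w = 0 :> 'cV[R[i]]_m.
  move=> w0; have /eqP : sqnorm w = 0 by apply/eqP; rewrite eq_le w0 sqnorm_ge0.
  rewrite psumr_eq0 => [/allP H|i _]; last exact: sqnormc_ge0.
  apply/matrixP => i j; rewrite (ord1 j) [RHS]mxE; apply: sqnormc_eq0.
  by apply/eqP; exact: (H i (mem_index_enum _)).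
have := HM v; have := HN v; have [->|cn] := eqVneq c 0.
  by rewrite expr0n mul0r add0r => HN' /Z ->; rewrite add0r.
have [->|dn] := eqVneq d 0.
  by rewrite expr0n mul0r addr0 => /Z -> HM'; rewrite addr0.
have cp : 0 < c by rewrite lt_neqAle eq_sym cn.
have dp : 0 < d by rewrite lt_neqAle eq_sym dn.
move=> H1 H2.
apply: (@le_trans _ _ ((c + d) * (sqnorm (M *m v) / c + sqnorm (N *m v) / d))).
  rewrite /sqnorm !mulr_suml -big_split /= mulr_sumr; apply: ler_sum => i _.
  by rewrite mxE sqnormc_addle.
rewrite expr2 -mulrA ler_pM2l ?addr_gt0 // mulrDl lerD // ler_pdivrMr // mulrAC -expr2 //.
Qed.

Lemma opbound0 (R : rcfType) (m n : nat) (c : R) : opbound (0 : 'M[R[i]]_(m, n)) c.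
Proof.
move=> v; rewrite mul0mx (_ : sqnorm 0 = 0); first exact: mulr_ge0 (sqr_ge0 _) (sqnorm_ge0 _).
by rewrite /sqnorm big1 // => i _; rewrite mxE /sqnormc /= expr0n addr0.
Qed.

Lemma opbound_sum (R : rcfType) (m n k : nat) (M : 'I_k -> 'M[R[i]]_(m, n)) (c : 'I_k -> R) :
  (forall i, 0 <= c i) -> (forall i, opbound (M i) (c i)) -> opbound (\sum_i M i) (\sum_i c i).
Proof.
move=> c0 H; suff [] : 0 <= \sum_i c i /\ opbound (\sum_i M i) (\sum_i c i) by [].
apply: (big_ind2 (fun x y => 0 <= y /\ opbound x y)) => //.
  by split=> //; exact: opbound0.
by move=> x y x' y' [? ?] [? ?]; split; [exact: addr_ge0|exact: opboundD].
Qed.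

Lemma opbound_le (R : rcfType) (m n : nat) (M : 'M[R[i]]_(m, n)) (c d : R) :
  0 <= c <= d -> opbound M c -> opbound M d.
Proof.
move=> /andP[c0 cd] H v; apply: (le_trans (H v)).
by rewrite ler_wpM2r ?sqnorm_ge0 // lerXn2r ?nnegrE // (le_trans c0).
Qed.

Lemma opboundM (R : rcfType) (m n p : nat) (M : 'M[R[i]]_(m, n)) (N : 'M[R[i]]_(n, p)) (c d : R) :
  opbound M c -> opbound N d -> opbound (M *m N) (c * d).
Proof.
move=> HM HN v; rewrite -mulmxA; apply: (le_trans (HM _)).
by rewrite (exprMn 2 c d) -[leRHS]mulrA; apply: ler_wpM2l; [exact: sqr_ge0|exact: HN].
Qed.

Lemma opbound_diag (R : rcfType) (n : nat) (x : 'I_n -> R) (c : R) :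
  (forall i, `|x i| <= c) -> opbound (diag_mx (\row_i (x i)%:C)) c.
Proof.
move=> H v; rewrite /sqnorm mulr_sumr; apply: ler_sum => i _.
rewrite mul_diag_mx !mxE sqnormcM sqnormc_real ler_wpM2r ?sqnormc_ge0 //.
by rewrite -real_normK ?num_real // lerXn2r ?nnegrE // (le_trans _ (H i)).
Qed.

Lemma char_poly_similar (F : comNzRingType) (n : nat) (P Q A : 'M[F]_n) :
  P *m Q = 1%:M -> char_poly (P *m A *m Q) = char_poly A.
Proof.
move=> PQ; rewrite /char_poly.
have PQ' : map_mx polyC P *m map_mx polyC Q = 1%:M by rewrite -map_mxM PQ map_mx1.
have -> : char_poly_mx (P *m A *m Q) = map_mx polyC P *m char_poly_mx A *m map_mx polyC Q.
  rewrite /char_poly_mx mulmxBr mulmxBl !map_mxM; congr (_ - _).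
  by rewrite scalar_mxC -mulmxA PQ' mulmx1.
by rewrite !det_mulmx mulrAC -det_mulmx PQ' det1 mul1r.
Qed.

(** The Gram matrices are similar, and [gram_eigs] is chosen through a predicate that involves only
    the characteristic polynomial, so the very same list is chosen. *)
Lemma sigma_unitary (R : rcfType) (m n : nat) (U : 'M[R[i]]_m) (V : 'M[R[i]]_n)
  (M : 'M[R[i]]_(m, n)) (j : nat) : U \is unitarymx -> V \is unitarymx ->
  sigma (U *m M *m V^t*) j = sigma M j.
Proof.
move=> /unitarymxP UU /unitarymxP VV.
have GE : adjmx (U *m M *m V^t*) *m (U *m M *m V^t*) = V *m (adjmx M *m M) *m V^t*.
  rewrite /adjmx (adjmxM (U *m M)) trmxCK (adjmxM U) !mulmxA.
  by rewrite -(mulmxA (V *m M^t*) (U^t*) U) (mulmx1C UU) mulmx1.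
have CE : char_poly (adjmx (U *m M *m V^t*) *m (U *m M *m V^t*)) = char_poly (adjmx M *m M).
  by rewrite GE char_poly_similar.
suff E : gram_eigs (U *m M *m V^t*) = gram_eigs M by rewrite /sigma /singvals E.
by apply: eq_xchoose => s; rewrite CE.
Qed.

Lemma unitary_diagonalization (C : numClosedFieldType) (n : nat) (A : 'M[C]_n) : A \is normalmx ->
  exists U (d : 'rV_n), U \is unitarymx /\ A = U^t* *m diag_mx d *m U.
Proof.
move=> An; exists (spectralmx A), (spectral_diag A); split; first exact: spectral_unitarymx.
by rewrite -invmx_unitary ?spectral_unitarymx //; apply/orthomx_spectralP.
Qed.

(** The Gram matrix is diagonalised by a unitary matrix; its eigenvalues are the squared norms [s i]
    of the images under [M]. Unique factorisation of the characteristic polynomial identifies them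
    with [gram_eigs] up to order. *)
Lemma singular_basis (R : rcfType) (m n : nat) (M : 'M[R[i]]_(m, n)) :
  [/\ size (singvals M) = n, sorted (fun x y : R => y <= x) (singvals M),
      all (fun x => 0 <= x) (singvals M) &
      exists2 V, V \is unitarymx & M^t* *m M *m V = V *m diag_mx (\row_(i < n) (sigma M i.+1 ^+ 2)%:C)].
Proof.
set G := M^t* *m M.
have GG : G^t* = G by rewrite adjmxM trmxCK.
have Gn : G \is normalmx by apply/normalmxP; rewrite GG.
have [P [d [Pu GE]]] := unitary_diagonalization Gn; have /unitarymxP PP := Pu.
pose s i := sqnorm (M *m (col i (P^t*))).
have s0 i : 0 <= s i := sqnorm_ge0 _.
have dE : diag_mx (d) = P *m G *m P^t*.
  by rewrite GE !mulmxA PP mul1mx -mulmxA PP mulmx1.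
have sE : d = \row_i (s i)%:C.
  apply/rowP => i; rewrite [RHS]mxE; apply: etrans (sqnormE _).
  have -> : d 0 i = diag_mx (d) i i by rewrite mxE eqxx.
  have rE : (col i (P^t*))^t* = row i P by apply/rowP => j; rewrite !mxE conjCK.
  have -> : (M *m col i (P^t*))^t* *m (M *m col i (P^t*)) = row i (P *m G) *m col i (P^t*).
    by rewrite adjmxM rE -mulmxA (mulmxA (M^t*)) -/G mulmxA row_mul.
  rewrite dE.
  by rewrite [LHS]mxE [RHS]mxE; apply: eq_bigr => j _; rewrite [row _ _ _ _]mxE [col _ _ _ _]mxE.
have cE : char_poly (adjmx M *m M) = \prod_(x <- [seq (s i)%:C | i <- enum 'I_n]) ('X - x%:P).
  have -> : char_poly (adjmx M *m M) = char_poly G by [].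
  have -> : char_poly G = char_poly (diag_mx (d)) by rewrite dE char_poly_similar.
  rewrite char_poly_trig; last by apply: diag_mx_is_trig.
  rewrite big_map big_enum /=; apply: eq_bigr => i _.
  by rewrite sE !mxE eqxx mulr1n.
have pE : perm_eq (gram_eigs M) [seq (s i)%:C | i <- enum 'I_n].
  by apply: prod_XsubC_eq; rewrite -cE; apply/eqP; rewrite eq_sym; exact: xchooseP (gram_eig_ex M).
have qE : perm_eq (singvals M) [seq Num.sqrt (s i) | i <- enum 'I_n].
  rewrite /singvals perm_sort; have := perm_map (fun z => Num.sqrt (complex.Re z)) pE.
  by rewrite -map_comp.
have sz : size (singvals M) = n by rewrite (perm_size qE) size_map size_enum_ord.
split=> //.
- by apply: sort_sorted => x y; exact: le_total.
- apply/allP => x; rewrite (perm_mem qE) => /mapP[i _ ->]; exact: sqrtr_ge0.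
have /eqP szt : size (singvals M) == n by rewrite sz.
(* The permutation [p] that sorts the singular values is extracted, to be applied to the columns of
   the eigenvector matrix. *)
have : perm_eq (singvals M) (mktuple (fun i => Num.sqrt (s i))) by rewrite /= -[X in perm_eq _ X]/[seq Num.sqrt (s i) | i <- enum 'I_n].
case/tuple_permP => p pE'.
have sig (i : 'I_n) : sigma M i.+1 ^+ 2 = s (p i).
  rewrite /sigma pE' (_ : nth 0 _ i = Num.sqrt (s (p i))) ?sqr_sqrtr //.
  by rewrite -tnth_nth tnth_mktuple tnth_mktuple.
exists (col_perm p (P^t*)).
  apply/unitarymxP/matrixP => i j; rewrite mxE.
  have /matrixP/(_ i j) := mulmx1C PP; rewrite !mxE => <-.
  rewrite [RHS](reindex_inj (@perm_inj _ p)); apply: eq_bigr => l _.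
  by rewrite !mxE conjCK.
have GP : G *m P^t* = P^t* *m diag_mx (d).
  by rewrite {1}GE -mulmxA PP mulmx1.
apply/matrixP => i j; rewrite mul_mx_diag [RHS]mxE [X in _ * X]mxE sig.
have /matrixP/(_ i (p j)) := GP; rewrite sE mul_mx_diag [RHS]mxE [X in _ * X]mxE.
rewrite [col_perm _ _ _ _]mxE => <-; rewrite [LHS]mxE [RHS]mxE.
by apply: eq_bigr => l _; rewrite [col_perm _ _ _ _]mxE.
Qed.

Lemma sigma_ge0 (R : rcfType) (m n : nat) (M : 'M[R[i]]_(m, n)) (j : nat) : 0 <= sigma M j.
Proof.
case: j => // j; have [_ _ /allP H _] := singular_basis M; rewrite /sigma.
have [jn|jn] := ltnP j (size (singvals M)); last by rewrite nth_default.
by apply: H; exact: mem_nth.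
Qed.

Lemma sigma_le (R : rcfType) (m n : nat) (M : 'M[R[i]]_(m, n)) (j k : nat) : (j <= k)%N ->
  sigma M k.+1 <= sigma M j.+1.
Proof.
move=> jk; have [_ Hs _ _] := singular_basis M.
have [kn|kn] := ltnP k (size (singvals M)); last by rewrite {1}/sigma nth_default // sigma_ge0.
have tr : transitive (fun x y : R => y <= x) by move=> y x z xy yz; exact: le_trans yz xy.
have rf : reflexive (fun x y : R => y <= x) by move=> x; exact: lexx.
by apply: (sorted_leq_nth tr rf 0 Hs) => //; rewrite inE // (leq_ltn_trans jk).
Qed.

Lemma sqnorm_mul_basis (R : rcfType) (m n : nat) (M : 'M[R[i]]_(m, n)) (V : 'M[R[i]]_n) (s : 'I_n -> R)
  (c : 'cV[R[i]]_n) : V \is unitarymx -> M^t* *m M *m V = V *m diag_mx (\row_i (s i ^+ 2)%:C) ->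
  sqnorm (M *m (V *m c)) = \sum_i s i ^+ 2 * sqnormc (c i 0).
Proof.
move=> /unitarymxP VV E; apply: (@complexI R); rewrite -sqnormE.
have -> : (M *m (V *m c))^t* *m (M *m (V *m c)) = c^t* *m (diag_mx (\row_i (s i ^+ 2)%:C) *m c).
  rewrite mulmxA adjmxM (adjmxM M) !mulmxA -(mulmxA (c^t* *m V^t*)).
  by rewrite -(mulmxA (c^t* *m V^t*)) E !mulmxA -(mulmxA (c^t*)) (mulmx1C VV) mulmx1.
rewrite mxE rmorph_sum; apply: eq_bigr => i _.
rewrite mul_diag_mx !mxE; transitivity ((s i ^+ 2)%:C * (sqnormc (c i 0))%:C).
  by rewrite sqnormcE; exact: mulrCA.
by rewrite -rmorphM.
Qed.

(** The easy half of the Eckart-Young theorem: the first [t + 1] right singular vectors span a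
    nonzero vector killed by [Y], on which [M] stretches by at least its singular value number
    [t + 1]. *)
Lemma sigma_le_opbound (R : rcfType) (m n t : nat) (M Y : 'M[R[i]]_(m, n)) (c : R) :
  0 <= c -> (\rank Y <= t)%N -> opbound (M - Y) c -> sigma M t.+1 <= c.
Proof.
move=> c0 rY H; have [sz _ _ [V Vu VE]] := singular_basis M.
have [tn|nt] := ltnP t n; last by rewrite /sigma nth_default // sz.
(* [E] includes the first [t + 1] coordinates; the transpose below is there because [kermx] is a row
   kernel. *)
pose E : 'M[R[i]]_(n, t.+1) := \matrix_(i, j) (i == j :> nat)%:R.
pose K := kermx (Y *m V *m E)^T.
have K0 : K != 0.
  rewrite kermx_eq0 /row_free mxrank_tr neq_ltn.
  rewrite (leq_ltn_trans _ (_ : t < t.+1)%N) // (leq_trans _ rY) //.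
  by rewrite (leq_trans (mxrankM_maxl _ _)) // mxrankM_maxl.
have /rowV0Pn[r rK r0] := K0.
have rE : Y *m (V *m (E *m r^T)) = 0.
  apply: trmx_inj; rewrite !mulmxA trmx_mul trmxK trmx0.
  by apply/sub_kermxP.
pose d := E *m r^T.
have dE (i : 'I_n) (it : (i < t.+1)%N) : d i 0 = r 0 (Ordinal it).
  rewrite mxE (bigD1 (Ordinal it)) //= !mxE eqxx mul1r big1 ?addr0 // => l li.
  by rewrite !mxE (_ : (i == l :> nat) = false) ?mul0r //; apply: contraNF li => /eqP e; apply/eqP/val_inj.
have d0 (i : 'I_n) : (t < i)%N -> d i 0 = 0.
  move=> ti; rewrite mxE big1 // => l _; rewrite !mxE (_ : (i == l :> nat) = false) ?mul0r //.
  by apply/negbTE; rewrite neq_ltn orbC (leq_trans (ltn_ord l)).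
have Nd : 0 < sqnorm d.
  rewrite lt_neqAle sqnorm_ge0 andbT eq_sym; apply: contra r0.
  rewrite psumr_eq0 => [/allP Hd|i _]; last exact: sqnormc_ge0.
  apply/eqP/rowP => j; have jn : (j < n)%N := leq_trans (ltn_ord j) tn.
  have /eqP/sqnormc_eq0 := Hd (Ordinal jn) (mem_index_enum _).
  by rewrite (dE (Ordinal jn) (ltn_ord j)) => rj; rewrite [RHS]mxE -rj; congr (r 0 _); apply: val_inj.
have H1 : sigma M t.+1 ^+ 2 * sqnorm d <= sqnorm (M *m (V *m d)).
  rewrite (sqnorm_mul_basis _ Vu VE) /sqnorm mulr_sumr; apply: ler_sum => i _.
  have [ti|it] := ltnP t i; first by rewrite d0 // /sqnormc /= expr0n addr0 !mulr0.
  by rewrite ler_wpM2r ?sqnormc_ge0 // lerXn2r ?nnegrE ?sigma_ge0 // sigma_le.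
have H2 := H (V *m d); rewrite mulmxBl rE subr0 sqnorm_unitary // in H2.
have := le_trans H1 H2; rewrite ler_pM2r // ler_sqr ?nnegrE ?sigma_ge0 //.
Qed.

Lemma norm2_le_opbound (R : rcfType) (m n : nat) (M : 'M[R[i]]_(m, n)) (c : R) :
  0 <= c -> opbound M c -> norm2 M <= c.
Proof.
by move=> c0 H; apply: (@sigma_le_opbound _ _ _ 0 M 0) => //; rewrite ?mxrank0 ?subr0.
Qed.

Lemma opbound_norm2 (R : rcfType) (m n : nat) (M : 'M[R[i]]_(m, n)) : opbound M (norm2 M).
Proof.
move=> v; have [_ _ _ [V Vu VE]] := singular_basis M.
have /unitarymxP VV := Vu.
have Vu' : V^t* \is unitarymx by rewrite trmxC_unitary.
have {1}-> : v = V *m (V^t* *m v) by rewrite mulmxA VV mul1mx.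
rewrite (sqnorm_mul_basis _ Vu VE).
have <- : sqnorm (V^t* *m v) = sqnorm v := sqnorm_unitary v Vu'.
rewrite /sqnorm mulr_sumr; apply: ler_sum => i _.
by rewrite ler_wpM2r ?sqnormc_ge0 // lerXn2r ?nnegrE ?sigma_ge0 // sigma_le.
Qed.

(** The pieces are [M v v^*] for the right singular vectors [v], so left singular vectors need not
    be constructed. *)
Lemma singular_decomposition (R : rcfType) (m n k : nat) (M : 'M[R[i]]_(m, n)) : (k <= n)%N ->
  exists (p : 'I_k -> 'cV[R[i]]_m) (q : 'I_k -> 'rV[R[i]]_n),
    (forall i, opbound (p i *m q i) (sigma M i.+1)) /\
    opbound (M - \sum_i p i *m q i) (sigma M k.+1).
Proof.
move=> kn; have [_ _ _ [V Vu VE]] := singular_basis M.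
have /unitarymxP VV := Vu.
have Vu' : V^t* \is unitarymx by rewrite trmxC_unitary.
pose D (P : pred nat) : 'M[R[i]]_n := diag_mx (\row_i (P i)%:R).
have DP (P : pred nat) (c : R) : 0 <= c -> (forall i : 'I_n, P i -> sigma M i.+1 <= c) ->
    opbound (M *m V *m D P *m V^t*) c.
  move=> c0 HP v; rewrite -!mulmxA (sqnorm_mul_basis _ Vu VE).
  have <- : sqnorm (V^t* *m v) = sqnorm v := sqnorm_unitary v Vu'.
  rewrite /sqnorm mulr_sumr; apply: ler_sum => i _.
  rewrite mul_diag_mx [X in sqnormc X]mxE [X in sqnormc (X * _)]mxE sqnormcM mulrA.
  rewrite ler_wpM2r ?sqnormc_ge0 //; case: (boolP (P i)) => Pi.
    by rewrite sqnormc_real expr1n mulr1 lerXn2r ?nnegrE ?sigma_ge0 ?HP.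
  by rewrite sqnormc_real expr0n mulr0 sqr_ge0.
pose w (i : 'I_k) := widen_ord kn i.
exists (fun i => M *m V *m delta_mx (w i) (0 : 'I_1)), (fun i => delta_mx (0 : 'I_1) (w i) *m V^t*).
have Di (i : 'I_k) : M *m V *m delta_mx (w i) (0 : 'I_1) *m (delta_mx (0 : 'I_1) (w i) *m V^t*) =
    M *m V *m D (pred1 (i : nat)) *m V^t*.
  rewrite !mulmxA -(mulmxA _ (delta_mx _ 0)) mul_delta_mx; congr (_ *m _ *m _).
  apply/matrixP => a b; rewrite !mxE /= -!val_eqE /= -mulrnA mulnb; congr (_%:R).
  by case: eqP => // ->; rewrite eq_sym.
split=> [i|].
  by rewrite Di; apply: DP; [exact: sigma_ge0|move=> j /eqP ->].
rewrite (eq_bigr _ (fun i _ => Di i)).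
have -> : M - \sum_(i < k) M *m V *m D (pred1 (i : nat)) *m V^t* =
    M *m V *m D (leq k) *m V^t*.
  rewrite -mulmx_suml -mulmx_sumr -{1}[M]mulmx1 -VV mulmxA -mulmxBl -{1}[M *m V]mulmx1 -mulmxBr.
  congr (_ *m _ *m _); apply/matrixP => a b; rewrite !mxE summxE.
  under eq_bigr => i _ do rewrite !mxE /=.
  have [->|ab] := eqVneq a b; last by rewrite !mulr0n big1 ?subr0.
  rewrite !mulr1n; have [kb|bk] := leqP k b.
    rewrite big1 ?subr0 // => i _; rewrite (_ : (b == i :> nat) = false) //.
    by apply/negbTE; rewrite neq_ltn orbC (leq_trans (ltn_ord i)).
  rewrite (bigD1 (Ordinal bk)) //= eqxx big1 ?addr0 ?subrr // => i ib.
  by rewrite (_ : (b == i :> nat) = false) //; apply: contraNF ib => /eqP e; apply/eqP/val_inj.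
by apply: DP; [exact: sigma_ge0|move=> j kj; exact: sigma_le].
Qed.

(** * Sylvester equations with diagonal coefficients *)

(** Take a top right singular vector [v], [u = X v] and [s = |u|]. The equation gives
    [u^* F v >= 2 a s^2], while twice its real part is at most [2 a s^2 + f^2 / (2 a)]; hence
    [s <= f / (2 a)]. *)
Lemma opbound_sylvester (R : rcfType) (m n : nat) (x : 'I_m -> R) (y : 'I_n -> R)
  (X F : 'M[R[i]]_(m, n)) (a f : R) : 0 < a -> 0 <= f ->
  (forall i, a <= x i) -> (forall j, a <= y j) ->
  diag_mx (\row_i (x i)%:C) *m X + X *m diag_mx (\row_j (y j)%:C) = F ->
  opbound F f -> opbound X (f / (2 * a)).
Proof.
move=> a0 f0 xa ya E HF.
suff H : norm2 X <= f / (2 * a).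
  by apply: opbound_le (opbound_norm2 X); rewrite sigma_ge0.
(* For [n = 0] there is no singular vector, and [norm2 X] is the default value 0. *)
case: n y X F ya E HF => [|n] y X F ya E HF.
  have [sz _ _ _] := singular_basis X.
  by rewrite /norm2 /sigma nth_default ?sz // divr_ge0 // mulr_ge0 // ltW.
have [_ _ _ [V Vu VE]] := singular_basis X.
pose e : 'cV[R[i]]_n.+1 := delta_mx 0 0.
pose v := V *m e; pose u := X *m v; pose s := norm2 X.
have Ne : sqnorm e = 1.
  rewrite /sqnorm (bigD1 ord0) //= mxE eqxx /sqnormc /= expr1n expr0n addr0 big1 ?addr0 // => i i0.
  by rewrite mxE (negPf i0) /= expr0n addr0.
have Nv : sqnorm v = 1 by rewrite sqnorm_unitary.
have Xu : X^t* *m u = (s ^+ 2)%:C *: v.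
  rewrite /u /v !mulmxA VE -mulmxA scalemxAr; congr (_ *m _).
  apply/matrixP => i j; rewrite mul_diag_mx !mxE (ord1 j).
  by have [->|i0] := eqVneq i 0; rewrite ?mulr0 // -?(negPf i0) ?mulr0.
have Nu : sqnorm u = s ^+ 2.
  apply: (@complexI R); rewrite -sqnormE /u adjmxM -mulmxA -/u Xu -scalemxAr mxE sqnormE Nv.
  by rewrite mulr1.
have dg k (z : 'I_k -> R) (w : 'cV[R[i]]_k) :
    (w^t* *m (diag_mx (\row_i (z i)%:C) *m w)) 0 0 = (\sum_i z i * sqnormc (w i 0))%:C.
  rewrite mxE rmorph_sum; apply: eq_bigr => i _.
  rewrite mul_diag_mx !mxE; transitivity ((z i)%:C * (sqnormc (w i 0))%:C).
    by rewrite sqnormcE; exact: mulrCA.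
  by rewrite -rmorphM.
have uFv : (u^t* *m (F *m v)) 0 0 =
    (\sum_i x i * sqnormc (u i 0) + s ^+ 2 * \sum_j y j * sqnormc (v j 0))%:C.
  rewrite -E mulmxDl mulmxDr mxE -!mulmxA dg rmorphD; congr (_ + _).
  rewrite (mulmxA (u^t*)).
  have -> : u^t* *m X = (s ^+ 2)%:C *: v^t*.
    rewrite -[X in _ *m X]trmxCK -adjmxM Xu; apply/matrixP => i j.
    by rewrite !mxE rmorphM; congr (_ * _); exact: conjc_real.
  by rewrite -scalemxAl [LHS]mxE dg -rmorphM.
have low k (z : 'I_k -> R) (w : 'cV[R[i]]_k) : (forall i, a <= z i) ->
    a * sqnorm w <= \sum_i z i * sqnormc (w i 0).
  by move=> za; rewrite /sqnorm mulr_sumr; apply: ler_sum => i _; rewrite ler_wpM2r ?sqnormc_ge0.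
have amgm (z w : 'cV[R[i]]_m) :
    2 * complex.Re ((z^t* *m w) 0 0) <= 2 * a * sqnorm z + sqnorm w / (2 * a).
  rewrite mxE raddf_sum /= mulr_sumr /sqnorm mulr_sumr mulr_suml -big_split /=.
  apply: ler_sum => i _; rewrite !mxE; move: (z i 0) (w i 0) => [p' q'] [p q].
  have H (r t : R) : 2 * (r * t) <= 2 * a * r ^+ 2 + t ^+ 2 / (2 * a).
    rewrite -subr_ge0 (_ : _ - _ = (2 * a * r - t) ^+ 2 / (2 * a)).
      by rewrite divr_ge0 ?sqr_ge0 // mulr_ge0 // ltW.
    by field; rewrite gt_eqF.
  have := H p' p; have := H q' q; rewrite /sqnormc /= mulrDr mulrDl; lra.
have up := amgm u (F *m v).
rewrite uFv /= in up.
have L1 := low _ x u xa; have L2 := low _ y v ya.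
rewrite Nu in up L1; rewrite Nv mulr1 in L2.
have Fv := HF v; rewrite Nv mulr1 in Fv.
have s0 : 0 <= s := sigma_ge0 X 1.
have L3 : s ^+ 2 * a <= s ^+ 2 * \sum_j y j * sqnormc (v j 0) by rewrite ler_wpM2l ?sqr_ge0.
have L4 : sqnorm (F *m v) / (2 * a) <= f ^+ 2 / (2 * a) by rewrite ler_pM2r // invr_gt0 mulr_gt0.
have a20 : 0 < 2 * a by rewrite mulr_gt0.
have L5 : 2 * a * s ^+ 2 <= f ^+ 2 / (2 * a).
  move: up L1 L3 L4; move: (\sum_i x i * _) (s ^+ 2 * \sum_j _) (_ / (2 * a)) (f ^+ 2 / _) => p q r z.
  by move=> up L1 L3 L4; lra.
rewrite -/s -(@ler_pXn2r _ 2) ?nnegrE ?divr_ge0 ?(ltW a20) //.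
by rewrite expr_div_n (expr2 (2 * a)) invfM mulrA -ler_pdivrMr ?invr_gt0 // invrK mulrC.
Qed.

(** For fixed [y] the left side is a polynomial in [s] of degree at most [k] that vanishes at
    [s = y]. The quotient has [k] coefficients, hence separates [s] from [y] in [k] terms. *)
Lemma antisymmetric_dvd (R : fieldType) (k : nat) (p : {poly R}) : (size p <= k.+1)%N ->
  exists g : R -> 'I_k -> R, forall s y : R,
    p.[s] * p.[- y] - p.[- s] * p.[y] = (s - y) * \sum_(l < k) s ^+ l * g y l.
Proof.
move=> sp.
pose Q y := p.[- y] *: p - p.[y] *: (p \Po - 'X).
have sQ y : (size (Q y) <= k.+1)%N.
  rewrite (leq_trans (size_polyD _ _)) // size_polyN geq_max !(leq_trans (size_scale_leq _ _)) //.
  rewrite (leq_trans (size_comp_poly_leq _ _)) // size_polyN size_polyX muln1.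
  by case: (size p) sp.
have QE s y : (Q y).[s] = p.[s] * p.[- y] - p.[- s] * p.[y].
  by rewrite !hornerE horner_comp !hornerE mulrC [X in _ - X]mulrC.
pose D y := Q y %/ ('X - y%:P).
have DE y : Q y = D y * ('X - y%:P).
  by rewrite divpK // dvdp_XsubCl rootE QE mulrC subrr.
have sD y : (size (D y) <= k)%N.
  by rewrite size_divp ?polyXsubC_eq0 // size_XsubC leq_subLR.
exists (fun y l => (D y)`_l) => s y.
rewrite -QE DE hornerM hornerXsubC mulrC; congr (_ * _).
by rewrite (horner_coef_wide _ (sD y)); apply: eq_bigr => l _; rewrite mulrC.
Qed.

(** The error of ADI is [rho(Dx) X rho(Dy)], where [rho(z) = r(z) / r(-z)] is at most [E] on the
    spectra. The rest has entries [X i j * (1 - rho(x i) * rho(y j))]; dividing by [x i + y j] is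
    exact by [antisymmetric_dvd] at [s = - x i], which leaves a product with inner dimension [k]. *)
Lemma low_rank_sylvester (R : rcfType) (m n k : nat) (x : 'I_m -> R) (y : 'I_n -> R)
  (X : 'M[R[i]]_(m, n)) (p : 'cV[R[i]]_m) (q : 'rV[R[i]]_n) (a b c E : R) :
  0 < a -> 0 <= E -> zolotarev_bound k a b E ->
  (forall i, a <= x i <= b) -> (forall j, a <= y j <= b) ->
  (forall i j, X i j * (x i + y j)%:C = (p *m q) i j) ->
  opbound X c ->
  exists2 Y : 'M[R[i]]_(m, n), (\rank Y <= k)%N & opbound (X - Y) (E ^+ 2 * c).
Proof.
move=> a0 E0 [r sr Hr] Hx Hy HX Xc.
pose rho (z : R) := r.[z] / r.[- z].
have rhoE z : a <= z <= b -> `|rho z| <= E.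
  move=> /Hr[r0 rE]; rewrite normrM normfV (gtr0_norm r0).
  by rewrite ler_pdivrMr.
pose D k' (z : 'I_k' -> R) : 'M[R[i]]_k' := diag_mx (\row_i (rho (z i))%:C).
have DE k' z : (forall i, a <= z i <= b) -> opbound (D k' z) E.
  by move=> Hz; apply: opbound_diag => i; exact: rhoE.
exists (X - D _ x *m X *m D _ y); last first.
  rewrite opprB addrC subrK (_ : E ^+ 2 * c = E * c * E); last by ring.
  by apply: opboundM; [apply: opboundM|]; do ?exact: DE.
have [g Hg] := antisymmetric_dvd sr.
pose P : 'M[R[i]]_(m, k) := \matrix_(i, l) (p i 0 * ((- x i) ^+ l / r.[- x i])%:C).
pose Z : 'M[R[i]]_(k, n) := \matrix_(l, j) (q 0 j * (- g (y j) l / r.[- y j])%:C).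
rewrite (_ : X - _ = P *m Z); first exact: mulmx_max_rank.
apply/matrixP => i j.
have [rx _] := Hr _ (Hx i); have [ry _] := Hr _ (Hy j).
have xy : 0 < x i + y j.
  have /andP[ax _] := Hx i; have /andP[ay _] := Hy j.
  by rewrite addr_gt0 // (lt_le_trans a0).
have xyC : (x i + y j)%:C != 0 by rewrite fmorph_eq0 gt_eqF.
apply: (mulIf xyC).
have -> : (X - D m x *m X *m D n y) i j = X i j * (1 - rho (x i) * rho (y j))%:C.
  rewrite mxE [Z in _ + Z]mxE mul_mx_diag mul_diag_mx !mxE.
  have CE (u v : R) : (1 - u * v)%:C = 1 - u%:C * v%:C :> R[i].
    by rewrite -rmorphM -[X in _ = X - _](rmorph1 (real_complex R)) -rmorphB.
  by rewrite CE mulrBr mulr1 mulrA [_%:C * X i j]mulrC.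
have -> : (P *m Z) i j = p i 0 * q 0 j *
    (- \sum_(l < k) (- x i) ^+ l * g (y j) l / (r.[- x i] * r.[- y j]))%:C.
  rewrite mxE -sumrN rmorph_sum mulr_sumr; apply: eq_bigr => l _.
  rewrite !mxE mulrACA -rmorphM; congr (_ * _%:C).
  by field; rewrite !gt_eqF.
rewrite mulrAC HX mxE big_ord1 -!mulrA; congr (_ * (_ * _)); rewrite -rmorphM; congr (_%:C).
have := Hg (- x i) (y j); rewrite opprK -mulr_suml /rho.
move: (\sum_(l < k) _) => S HS.
have -> : 1 - r.[x i] * (r.[- x i]^-1 * (r.[y j] / r.[- y j])) =
    (r.[- x i] * r.[- y j] - r.[x i] * r.[y j]) / (r.[- x i] * r.[- y j]).
  by field; rewrite !gt_eqF.
by rewrite HS; field; rewrite !gt_eqF.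
Qed.

Lemma triangular_sum (k : nat) : (\sum_(i < k) i.+1 = k * k.+1 %/ 2)%N.
Proof. by elim: k => [|k IH]; rewrite ?big_ord0 // big_ord_recr /= IH; lia. Qed.

Lemma triangular_double (k : nat) : (k * k.+1 %/ 2 * 2 = k * k.+1)%N.
Proof. by elim: k => // k IH; lia. Qed.

(** Piece [l], counted from 0, receives rank [k - l]. Its size decays like [mu^-l] and its relative
    error like [mu^-(k-l)], so all [k] errors have the same bound, of order [mu^-k]; the
    unapproximated remainder adds the final [+ 1]. *)
Lemma diag_sylvester_sigma (R : rcfType) (m n k : nat) (x : 'I_m -> R) (y : 'I_n -> R)
  (X F : 'M[R[i]]_(m, n)) (a b K mu c : R) :
  0 < a -> 1 <= K -> 0 < mu -> 0 <= c ->
  (forall i, a <= x i <= b) -> (forall j, a <= y j <= b) ->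
  diag_mx (\row_i (x i)%:C) *m X + X *m diag_mx (\row_j (y j)%:C) = F ->
  (forall j, (0 < j)%N -> exists2 E : R, zolotarev_bound j a b E & 0 <= E /\ E ^+ 2 <= c * mu ^- j) ->
  (forall j : nat, (j < n)%N -> sigma F j.+1 <= K * mu ^- j * norm2 F) ->
  (k < n)%N ->
  sigma X (k * k.+1 %/ 2).+1 <= K * b / a * (c * k%:R + 1) * mu ^- k * norm2 X.
Proof.
move=> a0 K1 mu0 c0 Hx Hy HXF HE HF kn.
have xy (i : 'I_m) (j : 'I_n) : 0 < x i + y j.
  by have /andP[? _] := Hx i; have /andP[? _] := Hy j; rewrite addr_gt0 // (lt_le_trans a0).
have ab : a <= b.
  have jn : (0 < n)%N := leq_ltn_trans (leq0n k) kn.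
  by have /andP[] := Hy (Ordinal jn); exact: le_trans.
have b0 : 0 < b := lt_le_trans a0 ab.
have [p [q [Hpq Hrest]]] := singular_decomposition F (ltnW kn).
pose solve (G : 'M[R[i]]_(m, n)) : 'M[R[i]]_(m, n) := \matrix_(i, j) (G i j / (x i + y j)%:C).
have xyC i j : (x i + y j)%:C != 0 by rewrite fmorph_eq0 gt_eqF.
have solveE G i j : solve G i j * (x i + y j)%:C = G i j by rewrite mxE divfK.
have entry (Z : 'M[R[i]]_(m, n)) i j :
    (diag_mx (\row_i (x i)%:C) *m Z + Z *m diag_mx (\row_j (y j)%:C)) i j = Z i j * (x i + y j)%:C.
  by rewrite mxE mul_diag_mx mul_mx_diag !mxE rmorphD mulrDr [_%:C * _]mulrC.
have solveS G : diag_mx (\row_i (x i)%:C) *m solve G + solve G *m diag_mx (\row_j (y j)%:C) = G.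
  by apply/matrixP => i j; rewrite entry solveE.
have solveB G f : 0 <= f -> opbound G f -> opbound (solve G) (f / (2 * a)).
  move=> f0; apply: opbound_sylvester (solveS G) => // i.
    by have /andP[] := Hx i.
  by have /andP[] := Hy i.
have XE : X = \sum_i solve (p i *m q i) + solve (F - \sum_i p i *m q i).
  apply/matrixP => i j; apply: (mulIf (xyC i j)); rewrite -entry HXF.
  rewrite mxE mulrDl solveE summxE mulr_suml (eq_bigr (fun l => (p l *m q l) i j)); last first.
    by move=> l _; rewrite solveE.
  by rewrite mxE [X in _ + (_ + X)]mxE summxE addrC subrK.
(* This factor [2 b] and the [1 / (2 a)] lost in solving the equation combine to [b / a]. *)
have NF : norm2 F <= 2 * b * norm2 X.
  have n0 : 0 <= norm2 X := sigma_ge0 X 1.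
  rewrite (_ : 2 * b * norm2 X = b * norm2 X + norm2 X * b); last by ring.
  apply: norm2_le_opbound; first by rewrite addr_ge0 ?mulr_ge0 // ltW.
  have Dx k' (z : 'I_k' -> R) : (forall i, a <= z i <= b) -> opbound (diag_mx (\row_i (z i)%:C)) b.
    move=> Hz; apply: opbound_diag => i; have /andP[az zb] := Hz i.
    by rewrite ger0_norm // (le_trans (ltW a0)).
  rewrite -HXF; apply: opboundD; rewrite ?mulr_ge0 ?(ltW b0) //.
    by apply: opboundM; [exact: Dx|exact: opbound_norm2].
  by apply: opboundM; [exact: opbound_norm2|exact: Dx].
have a20 : 0 < 2 * a by rewrite mulr_gt0.
have /fin_all_exists2[Y rY HY] (l : 'I_k) : exists2 Y : 'M[R[i]]_(m, n), (\rank Y <= k - l)%N &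
    opbound (solve (p l *m q l) - Y) (c * mu ^- (k - l) * (sigma F l.+1 / (2 * a))).
  have [|E Ez [E0 EE]] := HE (k - l)%N; first by rewrite subn_gt0.
  have S0 : 0 <= sigma F l.+1 / (2 * a) by rewrite divr_ge0 ?sigma_ge0 // ltW.
  have [Y rY HY] := low_rank_sylvester a0 E0 Ez Hx Hy (solveE _) (solveB _ _ (sigma_ge0 _ _) (Hpq l)).
  exists Y => //; apply: opbound_le HY.
  by rewrite mulr_ge0 ?sqr_ge0 //= ler_wpM2r.
have bnd j : (j < n)%N -> sigma F j.+1 / (2 * a) <= K * b / a * mu ^- j * norm2 X.
  move=> jn; rewrite ler_pdivrMr //; apply: (le_trans (HF j jn)).
  rewrite (_ : _ * (2 * a) = K * mu ^- j * (2 * b * norm2 X)); last first.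
    by have mj : mu ^+ j != 0; [rewrite expf_neq0 ?gt_eqF|field; rewrite mj gt_eqF].
  by rewrite ler_wpM2l // mulr_ge0 ?invr_ge0 ?exprn_ge0 // ?(ltW mu0) // (le_trans _ K1).
pose t := (k * k.+1 %/ 2)%N.
have tE : (\sum_(l < k) (k - l) = t)%N.
  rewrite /t (reindex_inj rev_ord_inj) /=; rewrite (eq_bigr (fun l : 'I_k => l.+1)); last first.
    by move=> l _; rewrite subKn.
  exact: triangular_sum.
have mk0 : 0 < mu ^- k by rewrite invr_gt0 exprn_gt0.
have C0 : 0 <= K * b / a * mu ^- k * norm2 X.
  by rewrite !mulr_ge0 ?invr_ge0 ?sigma_ge0 ?exprn_ge0 ?(ltW b0) ?(ltW a0) ?(ltW mu0) // (le_trans _ K1).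
rewrite (_ : K * b / a * (c * k%:R + 1) * mu ^- k * norm2 X =
   (c * k%:R + 1) * (K * b / a * mu ^- k * norm2 X)); last by ring.
have Herr : opbound (X - \sum_l Y l) (\sum_(l < k) c * mu ^- (k - l) * (sigma F l.+1 / (2 * a)) + sigma F k.+1 / (2 * a)).
  rewrite {1}XE addrAC -sumrB; apply: opboundD.
  - by apply: sumr_ge0 => l _; rewrite mulr_ge0 ?mulr_ge0 ?divr_ge0 ?invr_ge0 ?exprn_ge0 ?sigma_ge0 ?(ltW a20) ?(ltW mu0).
  - by rewrite divr_ge0 ?sigma_ge0 ?(ltW a20).
  - apply: opbound_sum => l //.
    by rewrite mulr_ge0 ?mulr_ge0 ?divr_ge0 ?invr_ge0 ?exprn_ge0 ?sigma_ge0 ?(ltW a20) ?(ltW mu0).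
  - exact: solveB (sigma_ge0 _ _) Hrest.
apply: (@le_trans _ _ (\sum_(l < k) c * mu ^- (k - l) * (sigma F l.+1 / (2 * a)) + sigma F k.+1 / (2 * a))).
  apply: sigma_le_opbound Herr.
    rewrite addr_ge0 ?divr_ge0 ?sigma_ge0 ?(ltW a20) //; apply: sumr_ge0 => l _.
    by rewrite mulr_ge0 ?mulr_ge0 ?divr_ge0 ?invr_ge0 ?exprn_ge0 ?sigma_ge0 ?(ltW a20) ?(ltW mu0).
  rewrite -/t -tE; elim/big_ind2: _ => [|s A s' A' H H'|l _]; rewrite ?mxrank0 //.
  by rewrite (leq_trans (mxrank_add _ _)) // leq_add.
rewrite [leRHS]mulrDl [1 * _]mul1r; apply: lerD; last exact: bnd.
set C := K * b / a * mu ^- k * norm2 X in C0 *.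
rewrite (_ : c * k%:R * C = \sum_(l < k) c * C); last first.
  by rewrite sumr_const card_ord -mulr_natr; ring.
apply: ler_sum => l _; rewrite -mulrA ler_wpM2l //.
have ln : (l < n)%N by apply: ltn_trans kn.
have ml0 : 0 <= mu ^- (k - l) by rewrite invr_ge0 exprn_ge0 // ltW.
apply: (le_trans (ler_wpM2l ml0 (bnd l ln))); rewrite /C.
have -> : mu ^- k = mu ^- (k - l) * mu ^- l by rewrite -invfM -exprD subnK // ltnW.
by rewrite [leLHS](_ : _ = K * b / a * (mu ^- (k - l) * mu ^- l) * norm2 X) //; ring.
Qed.

(** * From normal to diagonal coefficients *)

Lemma normal_real_diag (R : rcfType) (n : nat) (A : 'M[R[i]]_n) (P : R -> Prop) :
  A \is normalmx -> (forall lam : R[i], eigenvalue A lam -> exists2 x : R, lam = x%:C & P x) ->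
  exists U (x : 'I_n -> R), [/\ U \is unitarymx, forall i, P (x i) &
    A = U^t* *m diag_mx (\row_i (x i)%:C) *m U].
Proof.
move=> An HA; have [U [d [Uu AE]]] := unitary_diagonalization An.
have /unitarymxP UU := Uu.
have /fin_all_exists2[x dx Px] (i : 'I_n) : exists2 x : R, d 0 i = x%:C & P x.
  (* Eigenvectors are row vectors here: row [i] of [U] is one for [d 0 i], and it is nonzero because
     [U] is unitary. *)
  apply: HA; apply/eigenvalueP; exists (row i U).
    rewrite -row_mul AE !mulmxA UU mul1mx row_mul row_diag_mx -scalemxAl -rowE //.
  apply/eqP => Ui; have /matrixP/(_ i i) := UU.
  rewrite [RHS]mxE eqxx mxE big1 => [/esym/eqP|j _]; first by rewrite oner_eq0.
  by have /rowP/(_ j) := Ui; rewrite !mxE => ->; rewrite mul0r.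
have dE : \row_i (x i)%:C = d by apply/rowP => i; rewrite mxE dx.
by exists U, x; split; [exact: Uu|exact: Px|rewrite dE].
Qed.

Unset Implicit Arguments.

Theorem theorem6 (R : realType) (m n : nat) (A : 'M[R[i]]_m) (B : 'M[R[i]]_n)
  (X F : 'M[R[i]]_(m, n)) (a b K : R) :
  (n <= m)%N ->
  A \is normalmx -> B \is normalmx ->
  A *m X - X *m B = F ->
  0 < a -> a < b ->
  (forall lam : R[i], eigenvalue A lam -> exists2 x : R, lam = x%:C & - b <= x <= - a) ->
  (forall lam : R[i], eigenvalue B lam -> exists2 x : R, lam = x%:C & a <= x <= b) ->
  let mu2 : R := expR (pi ^+ 2 / ln (4 * b / a)) in
  1 <= K ->
  (forall j : nat, (j < n)%N -> sigma F j.+1 <= K * mu2 ^- j * norm2 F) ->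
  forall k : nat, (0 < k)%N ->
  let t : nat := (k * k.+1 %/ 2)%N in
  (1 <= t < n)%N ->
  sigma X t.+1 <=
    K * b / a * (6 * Num.sqrt (t%:R) + 1)
      * mu2 `^ (- ((Num.sqrt (8 * t%:R + 1) - 1) / 2)) * norm2 X.
Proof.
move=> _ An Bn E a0 ab HA HB mu2 K1 HF k k0 t /andP[_ tn].
have [U [x [Uu Hx AE]]] := normal_real_diag An HA.
have [W [y [Wu Hy BE]]] := normal_real_diag Bn HB.
have /unitarymxP UU := Uu; have /unitarymxP WW := Wu.
(* Negating the equation moves the spectrum of [- A] into [[a, b]]. The sign of the right-hand side
   is absorbed into [- U], again unitary, so its singular values are those of [F]. *)
have Nu : - U \is unitarymx.
  apply/unitarymxP; rewrite mulNmx -mulmxN (_ : - (- U)^t* = U^t*) //.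
  by apply/matrixP => i j; rewrite !mxE rmorphN opprK.
pose X' := U *m X *m W^t*; pose F' := - U *m F *m W^t*.
have sX j : sigma X' j = sigma X j := sigma_unitary _ _ Uu Wu.
have sF j : sigma F' j = sigma F j := sigma_unitary _ _ Nu Wu.
have E' : diag_mx (\row_i (- x i)%:C) *m X' + X' *m diag_mx (\row_j (y j)%:C) = F'.
  have -> : diag_mx (\row_i (- x i)%:C) = - diag_mx (\row_i (x i)%:C) :> 'M[R[i]]_m.
    by apply/matrixP => i j; rewrite !mxE rmorphN mulNrn.
  have UA : U *m A = diag_mx (\row_i (x i)%:C) *m U by rewrite AE !mulmxA UU mul1mx.
  have BW : B *m W^t* = W^t* *m diag_mx (\row_i (y i)%:C) by rewrite BE -!mulmxA WW mulmx1.
  rewrite /F' -E !mulNmx mulmxBr mulmxBl opprB [RHS]addrC; congr (- _ + _).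
    by rewrite /X' !mulmxA UA.
  by rewrite /X' -!mulmxA BW.
have mu0 : 0 < mu2 := expR_gt0 _.
have t2 : (t * 2 = k * k.+1)%N := triangular_double k.
(* Together with [t < n] this gives [k < n], so the decay of [sigma F] is available up to index
   [k]. *)
have kt : (k <= t)%N by move: k0 t2; clear; nia.
have HE j : (0 < j)%N -> exists2 C : R, zolotarev_bound j a b C & 0 <= C /\ C ^+ 2 <= 21 / 5 * mu2 ^- j.
  move=> j0; have [C HC [C0 C1]] := zolotarev_upper_bound j0 a0 ab.
  by exists C => //; split=> //; rewrite /mu2 -expRM_natl -expRN.
have c0 : 0 <= 21 / 5 :> R by lra.
have Hx' i : a <= - x i <= b by have /andP[] := Hx i; lra.
have HF' j : (j < n)%N -> sigma F' j.+1 <= K * mu2 ^- j * norm2 F'.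
  by rewrite /norm2 !sF; exact: HF.
have := diag_sylvester_sigma a0 K1 mu0 c0 Hx' Hy E' HE HF' (leq_ltn_trans kt tn).
rewrite -/t /norm2 !sX -/(norm2 X) => H.
have tE : t%:R = k%:R * (k%:R + 1) / 2 :> R.
  move/(congr1 (fun i => i%:R : R)): t2; rewrite !natrM -(addn1 k) natrD => <-.
  by rewrite mulfK // pnatr_eq0.
have K0 : 0 <= k%:R :> R by rewrite ler0n.
(* For a triangular number this is a perfect square, so the exponent in the claim is exactly [k]. *)
have -> : 8 * t%:R + 1 = (2 * k%:R + 1) ^+ 2 :> R by rewrite tE; field.
rewrite sqrtr_sqr ger0_norm; last by lra.
have -> : (2 * k%:R + 1 - 1) / 2 = k%:R :> R by field.
rewrite powRN powR_mulrn ?(ltW mu0) //.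
apply: (le_trans H).
rewrite ler_wpM2r ?sigma_ge0 // ler_wpM2r ?invr_ge0 ?exprn_ge0 ?(ltW mu0) //.
apply: ler_wpM2l; first by rewrite divr_ge0 ?mulr_ge0 ?(ltW a0) // ?(le_trans _ K1) //; lra.
rewrite lerD2r.
(* [21/5 = 6 * 7/10], and [(7 k / 10)^2 = 49 k^2 / 100 <= k (k + 1) / 2 = t]; the constant 6 thus
   absorbs [21/5]. *)
have -> : 21 / 5 * k%:R = 6 * Num.sqrt ((7 / 10 * k%:R) ^+ 2) :> R.
  by rewrite sqrtr_sqr ger0_norm; lra.
rewrite ler_pM2l // ler_wsqrtr // tE; move: (k%:R : R) K0 => u u0; nra.
Qed.
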